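(* Let $U=M_\xi$ be multiplication by the independent variable on the direct integral $\mathcal H\subset L^2(\mu;E)$, let $\mathbf B:\mathbb C^d\to\mathcal H$ be an isometry, let $\Gamma$ be a strict contraction on $\mathbb C^d$, and for a strict contraction $\Gamma'$ on $\mathbb C^d$ let $\theta_{\Gamma'}$ be the characteristic function of $T_{\Gamma'}=U+\mathbf B(\Gamma'-\mathbf I)\mathbf B^*U$ with coordinate operators $V=\mathbf B^*U$, $V_*=\mathbf B^*$. Then the characteristic functions $\theta_\Gamma$ and $\theta_{\mathbf 0}$ (the latter corresponding to $\Gamma'=\mathbf 0$) are related by $$\theta_\Gamma=D_{\Gamma^*}^{-1}(\theta_{\mathbf 0}-\Gamma)(\mathbf I-\Gamma^*\theta_{\mathbf 0})^{-1}D_\Gamma=D_{\Gamma^*}(\mathbf I-\theta_{\mathbf 0}\Gamma^* )^{-1}(\theta_{\mathbf 0}-\Gamma)D_\Gamma^{-1}.$$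
   Context: Direct integral: $\mu$ is a finite positive Borel measure on the unit circle $\mathbb T$; $E$ is a separable Hilbert space with orthonormal basis $(\varepsilon_n)_{n\ge1}$; $N:\mathbb T\to\mathbb N\cup\{\infty\}$ is measurable; $E(\xi)=\overline{\operatorname{span}}\{\varepsilon_n:1\le n\le N(\xi)\}$; $\mathcal H=\{f\in L^2(\mu;E): f(\xi)\in E(\xi)\ \mu\text{-a.e.}\}$. Strict contraction: $\|\Gamma x\|<\|x\|$ for all $x\ne0$. For a contraction $A$: $D_A=(\mathbf I-A^*A)^{1/2}$, $D_{A^*}=(\mathbf I-AA^* )^{1/2}$, $\mathfrak D_A=\operatorname{clos}\operatorname{Ran}D_A$. For $T=T_{\Gamma'}$ one has $\mathfrak D_T=U^*\operatorname{Ran}\mathbf B$, $\mathfrak D_{T^*}=\operatorname{Ran}\mathbf B$, so $V=\mathbf B^*U:\mathfrak D_T\to\mathbb C^d$ and $V_*=\mathbf B^*:\mathfrak D_{T^*}\to\mathbb C^d$ are unitary. The characteristic function of $T$ with these coordinate operators is the $d\times d$ matrix-valued analytic function $\theta_T(z)=V_*\bigl(-T+zD_{T^*}(\mathbf I-zT^* )^{-1}D_T\bigr)V^*$, $z\in\mathbb D$. The identities are between functions of $z\in\mathbb D$ (and hence also for boundary values a.e. on $\mathbb T$). *)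

(* Defs.v *)
From HB Require Import structures.
From mathcomp Require Import all_boot all_order all_algebra.
From mathcomp Require Import sesquilinear spectral complex generic_quotient.
From mathcomp Require Import ring_quotient.
From mathcomp Require Import all_classical all_reals all_analysis.
From mathcomp Require Import measurable_realfun.
From mathcomp Require Import ring lra.

Set Implicit Arguments.
Unset Strict Implicit.
Unset Printing Implicit Defensive.
Import Order.TTheory GRing.Theory Num.Theory.
Import numFieldNormedType.Exports.
Local Open Scope classical_set_scope.
Local Open Scope quotient_scope.
Local Open Scope ring_scope.

(* [hdot] is linear in its first argument and conjugate-linear in the second. *)
HB.mixin Record isPreHilbert (R : realType) (E : Type)
    of GRing.Lmodule R[i] E := {
  hdot : {dot E for (@Num.conj R[i])}
}.

#[short(type="preHilbertType")]
HB.structure Definition PreHilbert (R : realType) :=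
  {E of GRing.Lmodule R[i] E & isPreHilbert R E}.

Definition hnorm (R : realType) (E : preHilbertType R) (x : E) : R :=
  Num.sqrt (complex.Re (hdot x x)).

HB.mixin Record isHilbert (R : realType) (E : Type) of PreHilbert R E := {
  hcomplete : forall u : nat -> E,
    (forall e : R, 0 < e -> exists M, forall m n,
      (M <= m)%N -> (M <= n)%N -> hnorm (u m - u n) < e) ->
    exists l : E, forall e : R, 0 < e -> exists M, forall n,
      (M <= n)%N -> hnorm (u n - l) < e
}.

#[short(type="hilbertType")]
HB.structure Definition Hilbert (R : realType) :=
  {E of PreHilbert R E & isHilbert R E}.

Section CVec.
Variables (R : realType) (d : nat).
Local Notation C := R[i].

Definition cvdot (x y : 'cV[C]_d) : C := \sum_(i < d) x i 0 * Num.conj (y i 0).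

Lemma cvdot_bilinear : bilinear_for *%R (Num.conj \; *%R) cvdot.
Proof.
split=> [y a x x'|x a y y'] /=; rewrite /cvdot mulr_sumr -big_split /=;
  apply: eq_bigr => i _; rewrite !mxE ?rmorphD ?rmorphM /=; ring.
Qed.

HB.instance Definition _ := bilinear_isBilinear.Build C 'cV[C]_d 'cV[C]_d C
  *%R (Num.conj \; *%R) cvdot cvdot_bilinear.

Lemma cvdot_herm x y : cvdot x y = (-1) ^+ false * Num.conj (cvdot y x).
Proof.
rewrite expr0 mul1r /cvdot rmorph_sum; apply: eq_bigr => i _.
by rewrite rmorphM /= conjCK mulrC.
Qed.

HB.instance Definition _ := isHermitianSesquilinear.Build C 'cV[C]_d false
  Num.conj cvdot cvdot_herm.

Lemma cvdot_gt0 x : x != 0 -> 0 < cvdot x x.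
Proof.
move=> x0; rewrite lt_def sumr_ge0 ?andbT => [|i _]; last exact: mul_conjC_ge0.
apply: contra x0; rewrite psumr_eq0 => [/allP h|i _]; last exact: mul_conjC_ge0.
apply/eqP/matrixP => i j; rewrite ord1 mxE.
by have /eqP := h i (mem_index_enum i); move/eqP; rewrite mul_conjC_eq0 => /eqP.
Qed.

HB.instance Definition _ := isDotProduct.Build C 'cV[C]_d cvdot cvdot_gt0.

HB.instance Definition _ := isPreHilbert.Build R 'cV[C]_d cvdot.
End CVec.

Section Circle.
Variable R : realType.
Local Notation C := R[i].

Definition unit_circle : Type := set_type [set z : C^o | `|z| = 1].
HB.instance Definition _ := Topological.on unit_circle.
HB.instance Definition _ := isPointed.Build unit_circle
  (exist _ (1 : C^o) (mem_set (normr1 C : [set z : C^o | `|z| = 1] 1))).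

Definition circle : Type := g_sigma_algebraType (@open unit_circle).
HB.instance Definition _ := Measurable.on circle.

Definition circle_val (xi : circle) : C := set_val (xi : unit_circle).
End Circle.
Coercion circle_val : circle >-> complex.

Section PreHilbertTheory.
Variables (R : realType) (E : preHilbertType R).
Local Notation C := R[i].
Implicit Types (x y z : E) (a b : C).

Lemma hdotC x y : hdot x y = Num.conj (hdot y x).
Proof. by rewrite [LHS](@hermitian_subproof _ _ false) expr0 mul1r. Qed.

Lemma hdotDl x y z : hdot (x + y) z = hdot x z + hdot y z.
Proof. exact: linearDl. Qed.

Lemma hdotDr x y z : hdot x (y + z) = hdot x y + hdot x z.
Proof. exact: linearDr. Qed.

Lemma hdotNr x y : hdot x (- y) = - hdot x y.
Proof. exact: linearNr. Qed.

Lemma hdotBl x y z : hdot (x - y) z = hdot x z - hdot y z.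
Proof. exact: linearBl. Qed.

Lemma hdot0l x : hdot 0 x = 0. Proof. exact: linear0l. Qed.

Lemma hdotZl a x y : hdot (a *: x) y = a * hdot x y.
Proof. exact: linearZl_LR. Qed.

Lemma hdotZr a x y : hdot x (a *: y) = Num.conj a * hdot x y.
Proof. exact: linearZr_LR. Qed.

Lemma hdot_suml n (F : 'I_n -> E) x :
  hdot (\sum_(i < n) F i) x = \sum_(i < n) hdot (F i) x.
Proof. exact: linear_sumlz. Qed.

Lemma hdot_ge0 x : 0 <= hdot x x. Proof. exact: dnorm_ge0. Qed.

Lemma cRe_conj (a : C) : complex.Re (Num.conj a) = complex.Re a.
Proof. by case: a. Qed.

Lemma cIm_conj (a : C) : complex.Im (Num.conj a) = - complex.Im a.
Proof. by case: a. Qed.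

Lemma cRe_add (a b : C) : complex.Re (a + b) = complex.Re a + complex.Re b.
Proof. by case: a; case: b. Qed.

Lemma cIm_add (a b : C) : complex.Im (a + b) = complex.Im a + complex.Im b.
Proof. by case: a; case: b. Qed.

Lemma cRe_mul (a b : C) : complex.Re (a * b) =
  complex.Re a * complex.Re b - complex.Im a * complex.Im b.
Proof. by case: a; case: b. Qed.

Lemma cIm_mul (a b : C) : complex.Im (a * b) =
  complex.Re a * complex.Im b + complex.Im a * complex.Re b.
Proof. by case: a; case: b. Qed.

Lemma hdotxxE x : hdot x x = (complex.Re (hdot x x))%:C%C.
Proof. by rewrite RRe_real // ger0_real // hdot_ge0. Qed.

Lemma hnorm_ge0 x : 0 <= hnorm x. Proof. exact: sqrtr_ge0. Qed.

Lemma hnorm_sqr x : hnorm x ^+ 2 = complex.Re (hdot x x).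
Proof.
rewrite sqr_sqrtr //; have := hdot_ge0 x.
by rewrite lecE => /andP[].
Qed.

Lemma hnorm_eq0 x : (hnorm x ^+ 2 == 0) = (x == 0).
Proof.
rewrite hnorm_sqr; apply/eqP/eqP => [h|->]; last by rewrite linear0l.
by apply/eqP; rewrite -(dnorm_eq0 hdot) hdotxxE h.
Qed.

Lemma hnorm_sqrD x y : hnorm (x + y) ^+ 2 =
  hnorm x ^+ 2 + hnorm y ^+ 2 + complex.Re (hdot x y) *+ 2.
Proof.
rewrite !hnorm_sqr hdotDl !hdotDr !cRe_add [hdot y x]hdotC cRe_conj; ring.
Qed.

Lemma hnorm_sqrZ a x : hnorm (a *: x) ^+ 2 =
  (complex.Re a ^+ 2 + complex.Im a ^+ 2) * hnorm x ^+ 2.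
Proof.
rewrite !hnorm_sqr hdotZl hdotZr hdotxxE; case: a => a b /=; ring.
Qed.

Lemma hnorm_sqrN x : hnorm (- x) ^+ 2 = hnorm x ^+ 2.
Proof. by rewrite -scaleN1r hnorm_sqrZ /=; ring. Qed.

Lemma parallelogram x y : hnorm (x + y) ^+ 2 + hnorm (x - y) ^+ 2 =
  (hnorm x ^+ 2 + hnorm y ^+ 2) *+ 2.
Proof.
rewrite !hnorm_sqrD hnorm_sqrN hdotNr.
have -> : complex.Re (- hdot x y) = - complex.Re (hdot x y) by case: (hdot x y).
ring.
Qed.

Lemma hnorm_sqrD_le x y :
  hnorm (x + y) ^+ 2 <= (hnorm x ^+ 2 + hnorm y ^+ 2) *+ 2.
Proof. by rewrite -parallelogram lerDl sqr_ge0. Qed.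

Lemma Re_hdotE x y :
  complex.Re (hdot x y) = (hnorm (x + y) ^+ 2 - hnorm (x - y) ^+ 2) / 4.
Proof.
rewrite !hnorm_sqrD hnorm_sqrN hdotNr.
have -> : complex.Re (- hdot x y) = - complex.Re (hdot x y) by case: (hdot x y).
by field.
Qed.

Lemma Im_hdotE x y : complex.Im (hdot x y) = complex.Re (hdot x ('i%C *: y)).
Proof. by rewrite hdotZr; case: (hdot x y) => a b /=; ring. Qed.

Lemma Re_hdot_le x y :
  `|complex.Re (hdot x y)| <= hnorm x ^+ 2 + hnorm y ^+ 2.
Proof.
rewrite Re_hdotE.
have := parallelogram x y.
have := sqr_ge0 (hnorm (x + y)); have := sqr_ge0 (hnorm (x - y)).
rewrite ler_norml; move: (_ ^+ 2) (_ ^+ 2) (_ ^+ 2) (_ ^+ 2) => p q r s.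
by move=> *; apply/andP; split; lra.
Qed.

Lemma Im_hdot_le x y :
  `|complex.Im (hdot x y)| <= hnorm x ^+ 2 + hnorm y ^+ 2.
Proof.
rewrite Im_hdotE (le_trans (Re_hdot_le _ _)) // hnorm_sqrZ /=.
by rewrite expr0n expr1n /= add0r mul1r.
Qed.

Definition closed_span (S : set E) : set E :=
  [set x | forall e : R, 0 < e -> exists n (c : 'I_n -> C) (s : 'I_n -> E),
     (forall i, S (s i)) /\ hnorm (x - \sum_(i < n) c i *: s i) < e].

Lemma closed_span0 (S : set E) : closed_span S 0.
Proof.
move=> e e0; exists 0%N, (fun=> 0), (fun=> 0); split; first by case.
by rewrite big_ord0 subr0 /hnorm linear0l sqrtr0.
Qed.

Lemma closed_spanD (S : set E) x y :
  closed_span S x -> closed_span S y -> closed_span S (x + y).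
Proof.
move=> Sx Sy e e0; have e2 : 0 < e / 2 by rewrite divr_gt0.
have [n [c [s [Ss xs]]]] := Sx _ e2; have [m [b [t [St yt]]]] := Sy _ e2.
exists (n + m)%N, (fun i : 'I_(n + m) => match fintype.split i with inl j => c j | inr j => b j end),
  (fun i : 'I_(n + m) => match fintype.split i with inl j => s j | inr j => t j end); split.
  by move=> i; case: fintype.split.
rewrite big_split_ord /=.
under eq_bigr => i _ do rewrite (unsplitK (inl _ i)).
under [X in - (_ + X)]eq_bigr => i _ do rewrite (unsplitK (inr _ i)).
rewrite opprD addrACA; set u := (x - _) in xs *; set v := (y - _) in yt *.
rewrite -ltr_sqr ?nnegrE ?hnorm_ge0 ?ltW //.
apply: le_lt_trans (hnorm_sqrD_le _ _) _.
have := hnorm_ge0 u; have := hnorm_ge0 v; nra.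
Qed.

Lemma closed_spanZ (S : set E) a x : closed_span S x -> closed_span S (a *: x).
Proof.
move=> Sx e e0; set k := complex.Re a ^+ 2 + complex.Im a ^+ 2.
have k0 : 0 <= k by rewrite addr_ge0 ?sqr_ge0.
have [|n [c [s [Ss xs]]]] := Sx (e / (1 + k)); first by rewrite divr_gt0 ?ltr_pwDl.
exists n, (fun i => a * c i), s; split => //.
have -> : \sum_i (a * c i) *: s i = a *: \sum_i c i *: s i.
  by rewrite scaler_sumr; apply: eq_bigr => i _; rewrite scalerA.
rewrite -scalerBr -ltr_sqr ?nnegrE ?hnorm_ge0 ?ltW // hnorm_sqrZ -/k.
have h := hnorm_ge0 (x - \sum_i c i *: s i).
move: xs; rewrite ltr_pdivlMr ?ltr_pwDl // => xs.
move: (hnorm _) h xs => h h0 xs.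
have t0 : 0 <= h * (1 + k) by rewrite mulr_ge0 // addr_ge0.
apply: (@le_lt_trans _ _ ((h * (1 + k)) ^+ 2)); last by rewrite ltr_sqr ?nnegrE // ltW.
have := mulr_ge0 (sqr_ge0 h) k0; have := mulr_ge0 (sqr_ge0 h) (sqr_ge0 k).
have := sqr_ge0 h; lra.
Qed.
End PreHilbertTheory.

Record orthonormal_basis (R : realType) (E : hilbertType R) :=
  OrthonormalBasis {
  onb_val :> nat -> E;
  onb_orthonormal : forall m n, hdot (onb_val m) (onb_val n) = (m == n)%:R;
  onb_total : closed_span (range onb_val) = setT
}.

Section Parseval.
Variables (R : realType) (E : hilbertType R) (eps : orthonormal_basis E).
Local Notation C := R[i].
Implicit Types (x y : E).

Let nsq (a : C) : R := complex.Re a ^+ 2 + complex.Im a ^+ 2.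

Let nsqE (a : C) : a * Num.conj a = (nsq a)%:C%C.
Proof. by case: a => a b; rewrite /nsq; simpc; congr (_ +i* _)%C; ring. Qed.

Let proj k x : E := \sum_(i < k) hdot x (eps i) *: eps i.

Let projB k x y : proj k (x - y) = proj k x - proj k y.
Proof.
rewrite /proj -sumrB; apply: eq_bigr => i _.
by rewrite hdotBl scalerBl.
Qed.

Let hdot_proj k x (j : nat) : (j < k)%N -> hdot (proj k x) (eps j) = hdot x (eps j).
Proof.
move=> jk; rewrite hdot_suml (bigD1 (Ordinal jk)) //= hdotZl onb_orthonormal eqxx.
rewrite mulr1 big1 ?addr0 // => i ij.
rewrite hdotZl onb_orthonormal; have /negbTE -> : (i : nat) != j by [].
by rewrite mulr0.
Qed.

Let hdot_projl k x y : (forall j, (j < k)%N -> hdot y (eps j) = hdot x (eps j)) ->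
  hdot (proj k x) y = (\sum_(i < k) nsq (hdot x (eps i)))%:C%C.
Proof.
move=> h; rewrite hdot_suml rmorph_sum; apply: eq_bigr => i _.
by rewrite hdotZl [hdot _ y]hdotC h // nsqE.
Qed.

Let bessel k x : hnorm (x - proj k x) ^+ 2 =
  hnorm x ^+ 2 - \sum_(i < k) nsq (hdot x (eps i)).
Proof.
rewrite hnorm_sqrD hnorm_sqrN hdotNr (hdotC x).
have -> : forall a : C, complex.Re (- Num.conj a) = - complex.Re a by case.
rewrite [hnorm (proj _ _) ^+ 2]hnorm_sqr !hdot_projl //=; last first.
  by move=> j jk; rewrite hdot_proj.
ring.
Qed.

Let proj_span k n (c : 'I_n -> C) (s : 'I_n -> nat) : (forall i, (s i < k)%N) ->
  proj k (\sum_(i < n) c i *: eps (s i)) = \sum_(i < n) c i *: eps (s i).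
Proof.
move=> sk; rewrite /proj; under eq_bigr => j _ do rewrite hdot_suml scaler_suml.
rewrite exchange_big; apply: eq_bigr => i _ /=.
rewrite (bigD1 (Ordinal (sk i))) //= hdotZl onb_orthonormal eqxx mulr1.
rewrite big1 ?addr0 // => j ij; rewrite hdotZl onb_orthonormal.
have /negbTE -> : s i != j by rewrite eq_sym.
by rewrite mulr0 scale0r.
Qed.

Lemma parseval x : (fun k => \sum_(i < k) nsq (hdot x (eps i))) @ \oo
  --> hnorm x ^+ 2.
Proof.
apply/cvgrPdist_lt => e e0.
pose r := Num.sqrt e; have r0 : 0 < r by rewrite sqrtr_gt0.
have : closed_span (range eps) x by rewrite onb_total.
move=> /(_ r r0)[n [c [s [hs xs]]]].
have /choice[t ts] : forall i, exists m, eps m = s i.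
  by move=> i; have [m _ <-] := hs i; exists m.
exists (\max_(i < n) t i).+1 => // k /= tk.
rewrite -bessel ger0_norm ?sqr_ge0 //.
have -> : e = r ^+ 2 by rewrite sqr_sqrtr // ltW.
apply: le_lt_trans (_ : hnorm (x - \sum_i c i *: s i) ^+ 2 < _); last first.
  by rewrite ltr_sqr ?nnegrE ?hnorm_ge0 // ltW.
set y := \sum_i _; have py : proj k y = y.
  rewrite /y; under eq_bigr => i _ do rewrite -ts.
  apply: proj_span => i; apply: leq_trans tk; rewrite ltnS.
  exact: (leq_bigmax i).
have -> : x - proj k x = (x - y) - proj k (x - y).
  by rewrite projB py opprB addrA subrK.
rewrite bessel gerBl; apply: sumr_ge0 => i _.
by rewrite addr_ge0 ?sqr_ge0.
Qed.
End Parseval.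

(* For a separable target this coincides with strong (Bochner) measurability, by
   the Pettis theorem. *)
Definition weakly_measurable (R : realType) (E : preHilbertType R)
    (f : circle R -> E) : Prop :=
  forall e : E,
    measurable_fun setT (fun xi => complex.Re (hdot (f xi) e)) /\
    measurable_fun setT (fun xi => complex.Im (hdot (f xi) e)).

Section WeakMeasurability.
Variables (R : realType) (E : hilbertType R) (eps : orthonormal_basis E).
Local Notation C := R[i].
Implicit Types f g : circle R -> E.

Lemma weakly_measurable0 : weakly_measurable (fun=> 0 : E).
Proof.
by move=> e; split; under eq_fun do rewrite hdot0l; exact: measurable_cst.
Qed.

Lemma weakly_measurableD f g : weakly_measurable f -> weakly_measurable g ->
  weakly_measurable (fun xi => f xi + g xi).
Proof.
move=> mf mg e; have [mf1 mf2] := mf e; have [mg1 mg2] := mg e.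
split.
  rewrite (_ : (fun _ => _) = (fun xi => complex.Re (hdot (f xi) e)
    + complex.Re (hdot (g xi) e))); first exact: measurable_funD.
  by apply/funext => xi; rewrite hdotDl cRe_add.
rewrite (_ : (fun _ => _) = (fun xi => complex.Im (hdot (f xi) e)
  + complex.Im (hdot (g xi) e))); first exact: measurable_funD.
by apply/funext => xi; rewrite hdotDl cIm_add.
Qed.

Lemma weakly_measurableM (a : circle R -> C) f :
  measurable_fun setT (fun xi => complex.Re (a xi)) ->
  measurable_fun setT (fun xi => complex.Im (a xi)) ->
  weakly_measurable f -> weakly_measurable (fun xi => a xi *: f xi).
Proof.
move=> ma1 ma2 mf e; have [mf1 mf2] := mf e; split.
  rewrite (_ : (fun _ => _) =
      (fun xi => complex.Re (a xi) * complex.Re (hdot (f xi) e)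
               - complex.Im (a xi) * complex.Im (hdot (f xi) e))).
    by apply: measurable_funB; apply: measurable_funM.
  by apply/funext => xi; rewrite hdotZl cRe_mul.
rewrite (_ : (fun _ => _) =
    (fun xi => complex.Re (a xi) * complex.Im (hdot (f xi) e)
             + complex.Im (a xi) * complex.Re (hdot (f xi) e))).
  by apply: measurable_funD; apply: measurable_funM.
by apply/funext => xi; rewrite hdotZl cIm_mul.
Qed.

Lemma weakly_measurableZ (a : C) f :
  weakly_measurable f -> weakly_measurable (fun xi => a *: f xi).
Proof. by move=> mf; apply: weakly_measurableM => //; exact: measurable_cst. Qed.

Lemma measurable_hnorm_sqr f : weakly_measurable f ->
  measurable_fun setT (fun xi => hnorm (f xi) ^+ 2).
Proof.
move=> mf; apply: (measurable_fun_cvg (h := fun k xi => \sum_(i < k)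
  (complex.Re (hdot (f xi) (eps i)) ^+ 2
   + complex.Im (hdot (f xi) (eps i)) ^+ 2))).
  move=> k; apply: measurable_sum => i; have [m1 m2] := mf (eps i).
  by apply: measurable_funD; apply: measurable_funX.
by move=> xi _; exact: parseval.
Qed.

Lemma measurable_Re_hdot f g : weakly_measurable f -> weakly_measurable g ->
  measurable_fun setT (fun xi => complex.Re (hdot (f xi) (g xi))).
Proof.
move=> mf mg; under eq_fun do rewrite Re_hdotE.
apply: measurable_funM; last exact: measurable_cst.
apply: measurable_funB; apply: measurable_hnorm_sqr.
  exact: weakly_measurableD.
apply: weakly_measurableD => //.
by under eq_fun do rewrite -scaleN1r; exact: weakly_measurableZ.
Qed.

Lemma measurable_Im_hdot f g : weakly_measurable f -> weakly_measurable g ->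
  measurable_fun setT (fun xi => complex.Im (hdot (f xi) (g xi))).
Proof.
move=> mf mg; under eq_fun do rewrite Im_hdotE.
by apply: measurable_Re_hdot => //; exact: weakly_measurableZ.
Qed.
End WeakMeasurability.

Section CircleCoordinates.
Variable R : realType.
Local Notation C := R[i].

Lemma circle_norm (xi : circle R) : `|xi : C| = 1.
Proof. by case: xi => x xP; exact: (set_mem xP). Qed.

Lemma measurable_circle (h : C -> R) :
  (forall z w, (`|h w - h z|)%:C%C <= `|w - z|) ->
  measurable_fun setT (fun xi : circle R => h xi).
Proof.
move=> hlip; apply: (measurability _ (RGenOInfty.measurableE R)) => _ [_ [a ->] <-].
rewrite setTI; apply: sub_sigma_algebra.
exists [set z : C^o | a < h z]; last by apply/seteqP; split=> xi /=; rewrite in_itv /= andbT.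
rewrite openE => z /= az; apply/nbhs_ballP.
exists ((h z - a)%:C)%C => /=; first by rewrite ltcR subr_gt0.
move=> w; rewrite /ball /= => zw; have := le_lt_trans (hlip w z) zw.
rewrite ltcR => /ltr_normlP[_]; lra.
Qed.

Let le_norm_complex (a b : R) : (`|a|)%:C%C <= `|(a +i* b)%C|
  /\ (`|b|)%:C%C <= `|(a +i* b)%C|.
Proof.
rewrite normc_def !lecR /=; split; rewrite -sqrtr_sqr ler_wsqrtr //.
  by rewrite lerDl sqr_ge0.
by rewrite lerDr sqr_ge0.
Qed.

Lemma measurable_circle_Re :
  measurable_fun setT (fun xi : circle R => complex.Re xi).
Proof.
apply: measurable_circle => -[a b] [a' b'].
exact: (le_norm_complex (a' - a) (b' - b)).1.
Qed.

Lemma measurable_circle_Im :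
  measurable_fun setT (fun xi : circle R => complex.Im xi).
Proof.
apply: measurable_circle => -[a b] [a' b'].
exact: (le_norm_complex (a' - a) (b' - b)).2.
Qed.
End CircleCoordinates.

(* [N xi = None] encodes [N xi = oo]; indices start at 0, so that [eps n] is the
   (n+1)-st basis vector and the fiber is spanned by the first [N xi] of them. *)
Definition fiber (R : realType) (E : hilbertType R) (eps : nat -> E)
    (N : circle R -> option nat) (xi : circle R) : set E :=
  closed_span [set eps n | n in
    [set n | if N xi is Some m then (n < m)%N else True]].

Section DirectIntegral.
Variables (R : realType) (E : hilbertType R) (eps : orthonormal_basis E).
Variables (mu : {finite_measure set (circle R) -> \bar R}).
Variable N : circle R -> option nat.
Local Notation C := R[i].

Definition square_integrable (f : circle R -> E) : Prop :=
  weakly_measurable f /\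
  mu.-integrable setT (fun xi => (hnorm (f xi) ^+ 2)%:E).

Definition di_fun : {pred circle R -> E} :=
  [pred f | `[< square_integrable f /\
                {ae mu, forall xi, fiber eps N xi (f xi)} >]].

Lemma di_funP (f : circle R -> E) : reflect (square_integrable f /\
  {ae mu, forall xi, fiber eps N xi (f xi)}) (f \in di_fun).
Proof. exact: asboolP. Qed.

Lemma square_integrableP (f g h : circle R -> E) (a b : R) :
  square_integrable f -> square_integrable g -> weakly_measurable h ->
  (forall xi, hnorm (h xi) ^+ 2 <=
    a * hnorm (f xi) ^+ 2 + b * hnorm (g xi) ^+ 2) -> square_integrable h.
Proof.
move=> [_ fi] [_ gi] mh le; split=> //.
apply: (le_integrable measurableT _ _
  (integrableD measurableT (integrableZl measurableT a fi)
                           (integrableZl measurableT b gi))).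
  by apply/measurable_EFinP; exact: measurable_hnorm_sqr.
move=> xi _ /=; rewrite ger0_norm ?sqr_ge0 // lee_fin.
by rewrite (le_trans (le xi)) // ler_norm.
Qed.

Lemma square_integrable0 : square_integrable (fun=> 0).
Proof.
split; first exact: weakly_measurable0.
rewrite (_ : (fun _ => _) = cst 0%E); first exact: integrable0.
by apply/funext => xi; rewrite /hnorm hdot0l sqrtr0 expr0n.
Qed.

Lemma di_fun_submod_closed : submod_closed di_fun.
Proof.
split.
  apply/di_funP; split; first exact: square_integrable0.
  by apply: aeW => xi; exact: closed_span0.
move=> a f g /di_funP[fL fE] /di_funP[gL gE]; apply/di_funP; split.
  set k := complex.Re a ^+ 2 + complex.Im a ^+ 2.
  apply: (@square_integrableP f g _ (2 * k) 2 fL gL).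
    apply: weakly_measurableD gL.1.
    exact: weakly_measurableZ fL.1.
  move=> xi; apply: le_trans (hnorm_sqrD_le _ _) _.
  by rewrite hnorm_sqrZ -/k; rewrite le_eqVlt; apply/orP; left; apply/eqP; ring.
apply: filterS2 fE gE => xi fE gE.
by apply: closed_spanD gE; exact: closed_spanZ.
Qed.

HB.instance Definition _ := GRing.isSubmodClosed.Build C (circle R -> E)
  di_fun di_fun_submod_closed.

Record di_section := DISection {
  di_val :> circle R -> E; di_valP : di_val \in di_fun }.

HB.instance Definition _ := [isSub for di_val].
HB.instance Definition _ := [Choice of di_section by <:].
HB.instance Definition _ := [SubChoice_isSubLmodule of di_section by <:].

(* Sections that agree mu-almost everywhere are identified. *)
Definition di_null : {pred di_section} :=
  [pred f : di_section | `[< {ae mu, forall xi, f xi = 0} >]].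

Lemma di_nullP (f : di_section) :
  reflect {ae mu, forall xi, f xi = 0} (f \in di_null).
Proof. exact: asboolP. Qed.

Lemma di_valD (f g : di_section) xi : (f + g) xi = f xi + g xi.
Proof. by []. Qed.

Lemma di_valB (f g : di_section) xi : (f - g) xi = f xi - g xi.
Proof. by []. Qed.

Lemma di_valZ a (f : di_section) xi : (a *: f) xi = a *: f xi.
Proof. by []. Qed.

Lemma di_null_zmod_closed : zmod_closed di_null.
Proof.
split; first by apply/di_nullP; apply: aeW.
move=> f g /di_nullP f0 /di_nullP g0; apply/di_nullP.
by apply: filterS2 f0 g0 => xi; rewrite di_valB => -> ->; rewrite subr0.
Qed.

HB.instance Definition _ := GRing.isZmodClosed.Build di_section
  di_null di_null_zmod_closed.

Definition direct_integral : Type := Quotient.quot di_null.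
HB.instance Definition _ := GRing.Zmodule.on direct_integral.
HB.instance Definition _ := EqQuotient.on direct_integral.

Lemma di_eqP (f g : di_section) : \pi_direct_integral f = \pi_direct_integral g
  <-> {ae mu, forall xi, f xi = g xi}.
Proof.
split.
  move/eqP; rewrite -Quotient.idealrBE => /di_nullP.
  apply: filterS => xi; rewrite di_valB => /eqP; rewrite subr_eq0 => /eqP //.
move=> fg; apply/eqP; rewrite -Quotient.idealrBE; apply/di_nullP.
by apply: filterS fg => xi; rewrite di_valB => ->; rewrite subrr.
Qed.

Lemma repr_ae (f : di_section) :
  {ae mu, forall xi, repr (\pi_direct_integral f) xi = f xi}.
Proof. by apply/di_eqP; rewrite reprK. Qed.

Lemma di_piD (f g : di_section) : \pi_direct_integral (f + g) =
  \pi_direct_integral f + \pi_direct_integral g.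
Proof. exact: Quotient.pi_add. Qed.

Lemma di_pi0 : \pi_direct_integral 0 = 0.
Proof.
by apply: (addrI (\pi_direct_integral 0)); rewrite -di_piD !addr0.
Qed.

Definition di_scale (a : C) (x : direct_integral) : direct_integral :=
  \pi_direct_integral (a *: repr x).

Lemma di_piZ a (f : di_section) :
  \pi_direct_integral (a *: f) = di_scale a (\pi_direct_integral f).
Proof.
apply/di_eqP; apply: filterS (repr_ae f) => xi h.
by rewrite !di_valZ h.
Qed.

Lemma di_scaleA a b x : di_scale a (di_scale b x) = di_scale (a * b) x.
Proof. by rewrite -[x]reprK -!di_piZ scalerA reprK. Qed.
Lemma di_scale1 : left_id 1 di_scale.
Proof. by move=> x; rewrite -[x]reprK -!di_piZ scale1r. Qed.
Lemma di_scaleDr : right_distributive di_scale +%R.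
Proof.
move=> a x y; rewrite -[x]reprK -[y]reprK -di_piD -!di_piZ scalerDr.
exact: di_piD.
Qed.
Lemma di_scaleDl x : {morph di_scale^~ x : a b / a + b}.
Proof. move=> a b; rewrite -[x]reprK -!di_piZ scalerDl; exact: di_piD. Qed.

HB.instance Definition _ := GRing.Zmodule_isLmodule.Build C direct_integral
  di_scaleA di_scale1 di_scaleDr di_scaleDl.

Definition di_section_dot (f h : di_section) : C :=
  ((\int[mu]_xi complex.Re (hdot (f xi) (h xi)))%R +i*
   (\int[mu]_xi complex.Im (hdot (f xi) (h xi)))%R)%C.

Definition di_dot (x y : direct_integral) : C :=
  di_section_dot (repr x) (repr y).

Lemma di_square_integrable (f : di_section) : square_integrable f.
Proof. by have /di_funP[] := di_valP f. Qed.

Lemma integrable_Re_hdot (f h : di_section) :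
  mu.-integrable setT (EFin \o (fun xi => complex.Re (hdot (f xi) (h xi)))).
Proof.
have [mf fi] := di_square_integrable f; have [mh hi] := di_square_integrable h.
apply: (le_integrable measurableT _ _ (integrableD measurableT fi hi)).
  by apply/measurable_EFinP; exact: (measurable_Re_hdot eps).
by move=> xi _ /=; rewrite lee_fin (le_trans (Re_hdot_le _ _)) // ler_norm.
Qed.

Lemma integrable_Im_hdot (f h : di_section) :
  mu.-integrable setT (EFin \o (fun xi => complex.Im (hdot (f xi) (h xi)))).
Proof.
have [mf fi] := di_square_integrable f; have [mh hi] := di_square_integrable h.
apply: (le_integrable measurableT _ _ (integrableD measurableT fi hi)).
  by apply/measurable_EFinP; exact: (measurable_Im_hdot eps).
by move=> xi _ /=; rewrite lee_fin (le_trans (Im_hdot_le _ _)) // ler_norm.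
Qed.

Lemma ae_Rintegral (f g : circle R -> R) :
  mu.-integrable setT (EFin \o f) -> mu.-integrable setT (EFin \o g) ->
  {ae mu, forall xi, f xi = g xi} ->
  (\int[mu]_xi f xi)%R = (\int[mu]_xi g xi)%R.
Proof.
move=> /measurable_int mf /measurable_int mg fg; congr fine.
apply: ae_eq_integral => //.
by apply: filterS fg => xi /= ->.
Qed.

Lemma di_dot_pi (f h : di_section) :
  di_dot (\pi_direct_integral f) (\pi_direct_integral h) = di_section_dot f h.
Proof.
congr (_ +i* _)%C; apply: ae_Rintegral;
  do ?[exact: integrable_Re_hdot|exact: integrable_Im_hdot];
  by apply: filterS2 (repr_ae f) (repr_ae h) => xi -> ->.
Qed.

Lemma di_section_dotDl (f g h : di_section) :
  di_section_dot (f + g) h = di_section_dot f h + di_section_dot g h.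
Proof.
rewrite /di_section_dot; simpc; congr (_ +i* _)%C.
  rewrite -RintegralD //; do ?exact: integrable_Re_hdot.
  by apply: eq_Rintegral => xi _; rewrite di_valD hdotDl cRe_add.
rewrite -RintegralD //; do ?exact: integrable_Im_hdot.
by apply: eq_Rintegral => xi _; rewrite di_valD hdotDl cIm_add.
Qed.

Lemma di_section_dotZl a (f h : di_section) :
  di_section_dot (a *: f) h = a * di_section_dot f h.
Proof.
have iRe k : mu.-integrable setT
    (EFin \o (fun xi => k * complex.Re (hdot (f xi) (h xi)))).
  exact: (integrableZl measurableT k (integrable_Re_hdot f h)).
have iIm k : mu.-integrable setT
    (EFin \o (fun xi => k * complex.Im (hdot (f xi) (h xi)))).
  exact: (integrableZl measurableT k (integrable_Im_hdot f h)).
rewrite /di_section_dot.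
have -> : forall u v : R, a * (u +i* v)%C =
  ((complex.Re a * u - complex.Im a * v) +i*
   (complex.Re a * v + complex.Im a * u))%C by case: a {iRe iIm}.
congr (_ +i* _)%C.
  rewrite -!RintegralZl //; do ?[exact: integrable_Re_hdot|exact: integrable_Im_hdot].
  rewrite -RintegralB //.
  by apply: eq_Rintegral => xi _; rewrite di_valZ hdotZl cRe_mul.
rewrite -!RintegralZl //; do ?[exact: integrable_Re_hdot|exact: integrable_Im_hdot].
rewrite -RintegralD //.
by apply: eq_Rintegral => xi _; rewrite di_valZ hdotZl cIm_mul.
Qed.

Lemma di_section_dotC (f h : di_section) :
  di_section_dot f h = Num.conj (di_section_dot h f).
Proof.
rewrite /di_section_dot; simpc => /=; congr (_ +i* _)%C.
  by apply: eq_Rintegral => xi _; rewrite hdotC cRe_conj.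
rewrite -mulN1r -RintegralZl //; last exact: integrable_Im_hdot.
by apply: eq_Rintegral => xi _; rewrite hdotC cIm_conj mulN1r.
Qed.

Lemma di_dot_herm x y : di_dot x y = (-1) ^+ false * Num.conj (di_dot y x).
Proof. by rewrite expr0 mul1r /di_dot di_section_dotC. Qed.

Lemma di_dot_linearl a x x' y :
  di_dot (a *: x + x') y = a * di_dot x y + di_dot x' y.
Proof.
rewrite -[x]reprK -[x']reprK -[y]reprK.
have -> : a *: \pi_direct_integral (repr x) + \pi_direct_integral (repr x') =
    \pi_direct_integral (a *: repr x + repr x').
  by rewrite di_piD di_piZ.
by rewrite !di_dot_pi di_section_dotDl di_section_dotZl.
Qed.

Lemma di_dot_bilinear : bilinear_for *%R (Num.conj \; *%R) di_dot.
Proof.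
split=> [y a x x'|x a y y'] /=; first exact: di_dot_linearl.
have C1 u v : di_dot u v = Num.conj (di_dot v u).
  by rewrite di_dot_herm expr0 mul1r.
by rewrite C1 di_dot_linearl rmorphD rmorphM /= -!C1.
Qed.

HB.instance Definition _ := bilinear_isBilinear.Build C direct_integral
  direct_integral C *%R (Num.conj \; *%R) di_dot di_dot_bilinear.

HB.instance Definition _ := isHermitianSesquilinear.Build C direct_integral
  false Num.conj di_dot di_dot_herm.

Lemma di_dot_gt0 x : x != 0 -> 0 < di_dot x x.
Proof.
move=> x0.
have intE : (\int[mu]_xi complex.Re (hdot (repr x xi) (repr x xi)))%R =
    (\int[mu]_xi (hnorm (repr x xi) ^+ 2))%R.
  by apply: eq_Rintegral => xi _; rewrite hnorm_sqr.
have -> : di_dot x x = ((\int[mu]_xi (hnorm (repr x xi) ^+ 2))%R)%:C%C.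
  rewrite /di_dot /di_section_dot intE; congr (_ +i* _)%C.
  rewrite (_ : (fun _ => _) = cst 0) ?Rintegral_cst ?mul0r //.
  by apply/funext => xi /=; rewrite hdotxxE.
rewrite ltcR lt_def Rintegral_ge0 ?andbT; last by move=> *; exact: sqr_ge0.
apply: contra x0 => /eqP int0.
have [mx ix] := di_square_integrable (repr x).
have : (\int[mu]_xi `|(hnorm (repr x xi) ^+ 2)%:E| = 0)%E.
  under eq_integral do rewrite gee0_abs ?lee_fin ?sqr_ge0 //.
  rewrite -[LHS]fineK; last exact: integrable_fin_num.
  by rewrite -/(Rintegral mu setT _) int0.
move=> /(ae_eq_integral_abs mu measurableT (measurable_int mu ix)) h.
rewrite -[x]reprK -di_pi0; apply/eqP/di_eqP.
apply: filterS h => xi /(_ I)[] /eqP; rewrite hnorm_eq0 => /eqP -> //.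
Qed.

HB.instance Definition _ := isDotProduct.Build C direct_integral di_dot
  di_dot_gt0.

HB.instance Definition _ := isPreHilbert.Build R direct_integral di_dot.

Lemma di_mul_subproof (f : di_section) :
  (fun xi : circle R => (xi : C) *: f xi) \in di_fun.
Proof.
have /di_funP[fL fE] := di_valP f; apply/di_funP; split.
  apply: (@square_integrableP f f _ 1 0 fL fL).
    apply: weakly_measurableM fL.1; first exact: measurable_circle_Re.
    exact: measurable_circle_Im.
  move=> xi; rewrite mul1r mul0r addr0 hnorm_sqrZ.
  have : (complex.Re xi ^+ 2 + complex.Im xi ^+ 2)%:C%C = 1 :> C.
    by rewrite add_Re2_Im2 circle_norm expr1n.
  by move=> /complexI ->; rewrite mul1r.
by apply: filterS fE => xi; exact: closed_spanZ.
Qed.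

Definition di_mul (f : di_section) : di_section := DISection (di_mul_subproof f).

Definition mul_xi (x : direct_integral) : direct_integral :=
  \pi_direct_integral (di_mul (repr x)).

Lemma mul_xi_pi (f : di_section) :
  mul_xi (\pi_direct_integral f) = \pi_direct_integral (di_mul f).
Proof. by apply/di_eqP; apply: filterS (repr_ae f) => xi /= ->. Qed.
End DirectIntegral.

Section Operators.
Variables (R : realType) (H K : preHilbertType R).
Local Notation C := R[i].

(* Operators are everywhere defined plain functions.  Each construction below
   selects the operator with the stated property and is 0 when there is none.
   There is at most one: for [possqrt] this uses that [A] is bounded, as are
   [I - A^*A] and [I - AA^*] below for a contraction [A]. *)

(* Adjoint of the restriction of [A] to the subspace [D], as a map into [D]. *)
Definition adjoint_on (D : set H) (A : H -> K) : K -> H :=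
  xget (fun=> 0) [set B : K -> H | (forall y, D (B y)) /\
    (forall x y, D x -> hdot (A x) y = hdot x (B y))].

Definition adjoint (A : H -> K) : K -> H := adjoint_on setT A.

Definition possqrt (A : H -> H) : H -> H :=
  xget (fun=> 0) [set S : H -> H | [/\ linear S,
    (forall x, 0 <= hdot (S x) x) & (forall x, S (S x) = A x)]].

Definition opinv (A : H -> H) : H -> H :=
  xget (fun=> 0) [set B : H -> H | cancel A B /\ cancel B A].

Definition hclosure (S : set H) : set H :=
  [set x | forall e : R, 0 < e -> exists2 y, S y & hnorm (x - y) < e].
End Operators.

Section CharacteristicFunction.
Variables (R : realType) (H K : preHilbertType R).
Local Notation C := R[i].

Definition defect (A : H -> H) : H -> H :=
  possqrt (fun x => x - adjoint A (A x)).

Definition defect_adj (A : H -> H) : H -> H :=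
  possqrt (fun x => x - A (adjoint A x)).

Definition defect_space (A : H -> H) : set H := hclosure (range (defect A)).

(* [V] and [Vs] are the coordinate operators of the defect spaces of [T] and of
   its adjoint; [V] only matters through its restriction to [defect_space T]. *)
Definition charfun (T : H -> H) (V Vs : H -> K) (z : C) : K -> K := fun y =>
  let x := adjoint_on (defect_space T) V y in
  Vs (- T x + z *: defect_adj T
        (opinv (fun w => w - z *: adjoint T w) (defect T x))).
End CharacteristicFunction.

Section Matrices.
Variables (R : realType) (d : nat).
Local Notation C := R[i].

Definition mx_of_op (A : 'cV[C]_d -> 'cV[C]_d) : 'M[C]_d :=
  \matrix_(i, j) A (delta_mx j 0) i 0.

Definition adjmx (G : 'M[C]_d) : 'M[C]_d := map_mx Num.conj G^T.

Definition strict_contraction (G : 'M[C]_d) : Prop :=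
  forall x : 'cV[C]_d, x != 0 -> hnorm (G *m x) < hnorm x.

Definition defect_mx (G : 'M[C]_d) : 'M[C]_d := mx_of_op (defect (mulmx G)).

Definition defect_adj_mx (G : 'M[C]_d) : 'M[C]_d :=
  mx_of_op (defect_adj (mulmx G)).
End Matrices.

Section Perturbation.
Variables (R : realType) (E : hilbertType R) (eps : orthonormal_basis E).
Variables (mu : {finite_measure set (circle R) -> \bar R}).
Variables (N : circle R -> option nat) (d : nat).
Local Notation C := R[i].
Local Notation H := (direct_integral eps mu N).

Definition perturbation (B : 'cV[C]_d -> H) (G : 'M[C]_d) : H -> H :=
  fun x => mul_xi x + B ((G - 1%:M) *m adjoint B (mul_xi x)).

Definition theta (B : 'cV[C]_d -> H) (G : 'M[C]_d) (z : C) : 'M[C]_d :=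
  mx_of_op (charfun (perturbation B G)
    (fun x => adjoint B (mul_xi x)) (adjoint B) z).
End Perturbation.

(* Main.v *)
Require Import Defs.
From HB Require Import structures.
From mathcomp Require Import all_boot all_order all_algebra.
From mathcomp Require Import sesquilinear spectral complex.
From mathcomp Require Import all_classical all_reals all_analysis.
From mathcomp Require Import measurable_realfun.
From mathcomp Require Import ring lra.
Import Order.TTheory GRing.Theory Num.Theory.
Local Open Scope classical_set_scope.
Local Open Scope ring_scope.

(** Write [J = U^* B]. Since [U] is unitary and [B] is an isometry, the operator
    [T = U + B (G - I) B^* U] satisfies [I - T^* T = J (I - G^* G) J^*] and
    [I - T T^* = B (I - G G^* ) B^*]. Hence the defect operators of [T] are
    [J D_G J^*] and [B D_{G^*} B^*] ([possqrt_compression]), the coordinate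
    operator on the defect space of [T] has adjoint [J], and [T J = B G].
    Everything then happens in [C^d]:
    [[ theta_G = - G + D_{G^*} (z B^* (I - z T^* )^-1 J) D_G. ]]

    Put [F = z B^* (I - z U^* )^-1 J]. As [T^*] is a perturbation of [U^*] by
    [J (G^* - I) B^*], eliminating the vector [B^* w] from
    [(I - z T^* ) w = J u] turns the middle factor into
    [(I - F (G^* - I))^-1 F] ([opinv_perturb], [charfun_perturb]). For [G = 0]
    this says [theta_0 = (I + F)^-1 F], and substituting this back gives
    [[ theta_G = - G + D_{G^*} (I - theta_0 G^* )^-1 theta_0 D_G. ]]
    The two formulas of the theorem follow by matrix algebra from this,
    [D_G^2 = I - G^* G], [D_{G^*}^2 = I - G G^*] and [G D_G = D_{G^*} G]
    ([mobius_left], [mobius_right]).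

    The inverses exist because [F] has real part at least [-1/2]
    ([cauchy_mx_accretive]): this makes [I + F] invertible and [theta_0] a
    contraction, so that neither [theta_0 G^*] nor [G^* theta_0] has a nonzero
    fixed vector. On the direct integral, [U^*] and [(I - z U^* )^-1] are
    multiplications by the conjugate variable and by a bounded function
    ([mul_xi_inverse_exists], [resolvent_exists]).

    The facts about square roots come from a Sylvester equation: if [s X + X t = 0]
    with [s] positive definite and [t] positive, a trace computation gives
    [X = 0] ([sylvester_eq0]), which yields the uniqueness of positive roots and
    the relation [G D_G = D_{G^*} G]. *)

(** * Inner products *)

Section InnerProduct.
Context {R : realType} {H : preHilbertType R}.
Implicit Types x y : H.

Lemma hdotBr x y w : hdot w (x - y) = hdot w x - hdot w y.
Proof. exact: linearBr. Qed.

Lemma hdotNl x y : hdot (- x) y = - hdot x y.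
Proof. exact: linearNl. Qed.

Lemma hdot0r x : hdot x 0 = 0.
Proof. exact: linear0r. Qed.

Lemma hdot_eq0 x : (hdot x x == 0) = (x == 0).
Proof. exact: dnorm_eq0. Qed.

Lemma hdot_injr x y : (forall w, hdot w x = hdot w y) -> x = y.
Proof.
move=> h; apply/eqP; rewrite -subr_eq0 -hdot_eq0.
by rewrite hdotBr h subrr.
Qed.

Lemma hdotxx_hnorm x : hdot x x = (hnorm x ^+ 2)%:C%C.
Proof. by rewrite hnorm_sqr -hdotxxE. Qed.

Lemma complexi_neq0 : 'i%C != 0 :> R[i].
Proof.
apply/eqP => /(congr1 (fun a : R[i] => complex.Im a)) /= /eqP.
by rewrite oner_eq0.
Qed.

(** A positive form is real on the diagonal; evaluating it at [x + y] and
    [x + i y] recovers its hermitian symmetry. *)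
Lemma positive_symmetric (S : H -> H) : linear S ->
  (forall x, 0 <= hdot (S x) x) -> forall x y, hdot (S x) y = hdot x (S y).
Proof.
move=> Slin Spos x y.
have SE a u v : S (a *: u + v) = a *: S u + S v by exact: Slin.
have real u : hdot (S u) u = hdot u (S u).
  by rewrite [RHS]hdotC; apply/esym/conj_Creal; rewrite ger0_real.
have cross a : a * hdot (S x) y + Num.conj a * hdot (S y) x =
    a * hdot x (S y) + Num.conj a * hdot y (S x).
  have := real (a *: x + y); rewrite SE !hdotDl !hdotDr !hdotZl !hdotZr !real.
  (* the terms [<S x, x>] and [<S y, y>] cancel on both sides *)
  move=> h; apply: (addrI (a * (Num.conj a * hdot x (S x)) + hdot y (S y))).
  by apply: etrans (etrans _ h) _; ring.
have h1 := cross 1; have hi := cross 'i%C.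
have ci : Num.conj 'i%C = - 'i%C :> R[i] by apply/eqP; rewrite eq_complex /= oppr0 !eqxx.
rewrite rmorph1 !mul1r in h1; rewrite ci !mulNr -!mulrBr in hi.
have {}hi := mulfI complexi_neq0 hi.
apply: (@mulfI _ 2%:R); first by rewrite pnatr_eq0.
rewrite (_ : 2%:R * _ = (hdot (S x) y + hdot (S y) x)
  + (hdot (S x) y - hdot (S y) x)); last by ring.
rewrite h1 hi; ring.
Qed.

End InnerProduct.

Lemma hnorm_le_hdot {R : realType} {H K : preHilbertType R} (x : H) (y : K) :
  (hnorm x <= hnorm y) = (hdot x x <= hdot y y).
Proof. by rewrite !hdotxx_hnorm lecR ler_sqr ?nnegrE ?hnorm_ge0. Qed.

Lemma hnorm_lt_hdot {R : realType} {H K : preHilbertType R} (x : H) (y : K) :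
  (hnorm x < hnorm y) = (hdot x x < hdot y y).
Proof. by rewrite !hdotxx_hnorm ltcR ltr_sqr ?nnegrE ?hnorm_ge0. Qed.

(** * Positive matrices and their square roots *)

Section PositiveMatrices.
Context {R : realType} {d : nat}.
Local Notation C := R[i].
Implicit Types (G X s t : 'M[C]_d) (x y : 'cV[C]_d).

Lemma adjmxE G i j : adjmx G i j = Num.conj (G j i).
Proof. by rewrite /adjmx !mxE. Qed.

Lemma adjmxK G : adjmx (adjmx G) = G.
Proof. by apply/matrixP => i j; rewrite !adjmxE conjCK. Qed.

Lemma adjmx1 : adjmx (1%:M : 'M[C]_d) = 1%:M.
Proof. by rewrite /adjmx trmx1 map_mx1. Qed.

Lemma adjmxB G X : adjmx (G - X) = adjmx G - adjmx X.
Proof. by apply/matrixP => i j; rewrite !(mxE, adjmxE) rmorphB. Qed.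

Lemma adjmx0 : adjmx (0 : 'M[C]_d) = 0.
Proof. by apply/matrixP => i j; rewrite !(mxE, adjmxE) rmorph0. Qed.

Lemma hdot_mulmxl G x y : hdot (G *m x) y = hdot x (adjmx G *m y).
Proof.
rewrite /hdot /= /cvdot.
under eq_bigr => i _ do rewrite mxE mulr_suml.
rewrite exchange_big /=; apply: eq_bigr => j _.
rewrite mxE rmorph_sum mulr_sumr; apply: eq_bigr => i _.
by rewrite adjmxE rmorphM /= conjCK; ring.
Qed.

Lemma hdot_mulmxr G x y : hdot x (G *m y) = hdot (adjmx G *m x) y.
Proof. by rewrite hdot_mulmxl adjmxK. Qed.

Lemma mxtrace_adj_hdot G X :
  \tr (adjmx G *m X) = \sum_i hdot (col i X) (col i G).
Proof.
apply: eq_bigr => i _; rewrite mxE; apply: eq_bigr => k _.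
by rewrite adjmxE !mxE mulrC.
Qed.

Definition psdmx s : Prop := forall x, 0 <= hdot (s *m x) x.
Definition pdmx s : Prop := forall x, x != 0 -> 0 < hdot (s *m x) x.

Lemma pdmx_psd s : pdmx s -> psdmx s.
Proof.
move=> ps x; have [->|/ps/ltW//] := eqVneq x 0.
by rewrite mulmx0 hdot0l.
Qed.

Lemma unitmx_ker0 s : (forall x, s *m x = 0 -> x = 0) -> s \in unitmx.
Proof.
move=> s0; rewrite -unitmx_tr -row_free_unit -kermx_eq0.
apply/eqP/row_matrixP => i; rewrite row0; apply: trmx_inj; rewrite trmx0; apply: s0.
by apply: trmx_inj; rewrite trmx_mul trmxK -row_mul mulmx_ker row0 trmx0.
Qed.

Lemma pdmx_unit s : pdmx s -> s \in unitmx.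
Proof.
move=> ps; apply: unitmx_ker0 => x sx0; apply/eqP/negPn/negP => /ps.
by rewrite sx0 hdot0l ltxx.
Qed.

Lemma psdmx_adj s : psdmx s -> adjmx s = s.
Proof.
move=> ps; have lin : linear (mulmx s : 'cV[C]_d -> 'cV[C]_d).
  by move=> a x y; rewrite mulmxDr scalemxAr.
have sym := positive_symmetric _ lin ps.
have e x : adjmx s *m x = s *m x.
  by apply: hdot_injr => w; rewrite -hdot_mulmxl sym.
by apply/matrixP => i j; have /matrixP/(_ i 0) := e (delta_mx j 0); rewrite -!colE !mxE.
Qed.

(** Multiplying the equation by [adjmx X] and taking traces gives a sum of
    nonnegative terms [<s X e_i, X e_i>] and [<t X^* e_i, X^* e_i>] equal to
    zero. Both the uniqueness of the positive square root and the relation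
    [G D_G = D_{G^*} G] are instances. *)
Lemma sylvester_eq0 s t X : pdmx s -> psdmx t -> s *m X + X *m t = 0 -> X = 0.
Proof.
move=> ps pt eq0.
have : \tr (adjmx X *m (s *m X)) + \tr (adjmx (adjmx X) *m (t *m adjmx X)) = 0.
  rewrite adjmxK (mulmxA X) (mxtrace_mulC (X *m t)) -mxtraceD -mulmxDr.
  by rewrite eq0 mulmx0 mxtrace0.
rewrite !mxtrace_adj_hdot => /eqP.
rewrite paddr_eq0; last 2 first.
- by apply: sumr_ge0 => i _; rewrite colE -mulmxA -colE; exact: pdmx_psd.
- by apply: sumr_ge0 => i _; rewrite colE -mulmxA -colE; exact: pt.
case/andP => + _; rewrite psumr_eq0 => [/allP h|i _]; last first.
  by rewrite colE -mulmxA -colE; exact: pdmx_psd.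
apply/matrixP => i j.
have /eqP c0 : hdot (s *m col j X) (col j X) == 0.
  by have := h j (mem_index_enum j); rewrite colE -mulmxA -colE.
have [/matrixP/(_ i 0)|/ps] := eqVneq (col j X) 0; first by rewrite !mxE.
by rewrite c0 ltxx.
Qed.

(** The difference of the two roots solves a Sylvester equation:
    [s (s - t) + (s - t) t = s^2 - t^2]. *)
Lemma psd_sqrt_unique s t : pdmx s -> psdmx t -> s *m s = t *m t -> s = t.
Proof.
move=> ps pt st; apply/eqP; rewrite -subr_eq0; apply/eqP.
apply: sylvester_eq0 ps pt _.
by rewrite mulmxBr mulmxBl st addrA subrK subrr.
Qed.

Lemma hdot_diag_mx (D : 'rV[C]_d) x :
  hdot (diag_mx D *m x) x = \sum_i D 0 i * (x i 0 * Num.conj (x i 0)).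
Proof. by apply: eq_bigr => i _; rewrite mul_diag_mx mxE mulrA. Qed.

Lemma pd_sqrt_exists G : pdmx G -> exists2 s, pdmx s & s *m s = G.
Proof.
move=> pG; pose P := spectralmx G; pose D := spectral_diag G.
have aG := psdmx_adj _ (pdmx_psd _ pG).
have Pu : P \is unitarymx by exact: spectral_unitarymx.
have GE : G = adjmx P *m diag_mx D *m P.
  have /orthomx_spectralP : G \is normalmx.
    apply: hermitian_normalmx; rewrite is_hermitianmxE expr0 scale1r.
    by apply/eqP; rewrite -[RHS]/(adjmx G) aG.
  by rewrite /= invmx_unitary.
have PP : P *m adjmx P = 1%:M by apply/unitarymxP: Pu.
have P'P : adjmx P *m P = 1%:M by apply: mulmx1C.
pose v i := adjmx P *m (delta_mx i 0 : 'cV[C]_d).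
have vE i : P *m v i = delta_mx i 0 by rewrite /v mulmxA PP mul1mx.
(* [v i] is an eigenvector with eigenvalue [D 0 i] *)
have D0 i : 0 < D 0 i.
  have vn0 : v i != 0.
    apply/eqP => v0; have := vE i; rewrite v0 mulmx0 => /matrixP/(_ i 0)/eqP.
    by rewrite !mxE !eqxx eq_sym oner_eq0.
  have := pG _ vn0; rewrite {1}GE -!mulmxA hdot_mulmxl adjmxK !vE hdot_diag_mx.
  rewrite (bigD1 i) //= big1 ?addr0 => [|j /negbTE ji].
    by rewrite mxE !eqxx /= mulr1n rmorph1 !mulr1.
  by rewrite !mxE ji /= !mul0r mulr0.
pose Q : 'rV[C]_d := \row_i sqrtC (D 0 i).
exists (adjmx P *m diag_mx Q *m P).
  move=> x x0; rewrite -!mulmxA hdot_mulmxl adjmxK hdot_diag_mx.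
  have Px0 : P *m x != 0.
    by apply: contra x0 => /eqP e; rewrite -[x]mul1mx -P'P -mulmxA e mulmx0.
  have Q0 i : 0 < Q 0 i by rewrite mxE sqrtC_gt0.
  rewrite lt_def sumr_ge0 ?andbT => [|i _]; last first.
    by rewrite mulr_ge0 ?mul_conjC_ge0 // ltW.
  apply: contra Px0; rewrite psumr_eq0 => [/allP h|i _]; last first.
    by rewrite mulr_ge0 ?mul_conjC_ge0 // ltW.
  apply/eqP/matrixP => i j; rewrite ord1 [RHS]mxE; apply/eqP.
  have := h i (mem_index_enum i); rewrite /= mulf_eq0 mul_conjC_eq0.
  by rewrite gt_eqF.
rewrite !mulmxA -(mulmxA _ P) PP mulmx1 -(mulmxA (adjmx P) (diag_mx Q)).
rewrite (_ : diag_mx Q *m diag_mx Q = diag_mx D) //.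
rewrite mulmx_diag; congr diag_mx; apply/rowP => i; rewrite !mxE.
by rewrite -expr2 sqrtCK.
Qed.

End PositiveMatrices.

(** * Adjoints, inverses and square roots of operators *)

Lemma cV_sum_delta {R : pzRingType} {d : nat} (x : 'cV[R]_d) :
  x = \sum_j x j 0 *: delta_mx j 0.
Proof.
apply/matrixP => i k; rewrite ord1 summxE (bigD1 i) //= big1 ?addr0.
  by rewrite !mxE !eqxx mulr1.
by move=> j /negbTE ji; rewrite !mxE eq_sym ji mulr0.
Qed.

Lemma mx_of_opE {R : realType} {d : nat}
    (f : {linear 'cV[R[i]]_d -> 'cV[R[i]]_d}) x :
  mx_of_op f *m x = f x.
Proof.
rewrite [in RHS](cV_sum_delta x) linear_sum; apply/matrixP => i k.
rewrite ord1 mxE summxE.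
by apply: eq_bigr => j _; rewrite linearZ !mxE mulrC.
Qed.

Lemma mx_of_op_mulmx {R : realType} {d : nat} (M : 'M[R[i]]_d) : mx_of_op (mulmx M) = M.
Proof. by apply/matrixP => i j; rewrite mxE -colE mxE. Qed.

Section OperatorIdentification.
Context {R : realType} {H K : preHilbertType R}.

Lemma adjoint_onE (D : set H) (A : H -> K) (A' : K -> H) :
  (forall x y, D x -> D y -> D (x - y)) -> (forall y, D (A' y)) ->
  (forall x y, D x -> hdot (A x) y = hdot x (A' y)) -> adjoint_on D A = A'.
Proof.
move=> DB DA' AA'; apply: xget_unique => // A'' [DA'' AA''].
apply/funext => y; apply/eqP; rewrite -subr_eq0 -hdot_eq0 hdotBr.
by rewrite -AA'' ?AA' ?subrr //; exact: DB.
Qed.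

Lemma adjointE (A : H -> K) (A' : K -> H) :
  (forall x y, hdot (A x) y = hdot x (A' y)) -> adjoint A = A'.
Proof. by move=> h; apply: adjoint_onE. Qed.

Lemma opinvE (A A' : H -> H) : cancel A A' -> cancel A' A -> opinv A = A'.
Proof.
move=> AA' A'A; apply: xget_unique => // A'' [AA'' _].
by apply/funext => x; rewrite -{1}[x]A'A AA''.
Qed.

Lemma linear_of_adjoint (A : H -> K) (A' : K -> H) :
  (forall x y, hdot (A x) y = hdot x (A' y)) -> linear A'.
Proof.
move=> h a x y; apply: hdot_injr => w.
by rewrite -h !hdotDr !hdotZr -!h.
Qed.

(** Polarization: the norm determines the real part of the inner product, and
    multiplying one argument by [i] turns imaginary parts into real ones. *)
Lemma isometry_hdot (A : H -> K) : linear A ->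
  (forall x, hnorm (A x) = hnorm x) -> forall x y, hdot (A x) (A y) = hdot x y.
Proof.
move=> Alin Aiso x y.
pose A' : {linear H -> K} := HB.pack A (GRing.isLinear.Build _ _ _ _ A Alin).
have re u v : complex.Re (hdot (A u) (A v)) = complex.Re (hdot u v).
  by rewrite !Re_hdotE -(linearD A') -(linearB A') /= !Aiso.
apply/eqP; rewrite eq_complex re eqxx /= !Im_hdotE.
by rewrite -[_ *: A y](linearZ_LR A') re.
Qed.

End OperatorIdentification.

Section Compression.
Context {R : realType} {H : preHilbertType R} {d : nat}.
Local Notation C := R[i].
Context (J : {linear 'cV[C]_d -> H}) (Js : {linear H -> 'cV[C]_d}).
Context (JJs : forall x y, hdot (J x) y = hdot x (Js y)).
Context (JsJ : forall x, Js (J x) = x).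

(** [x - J (Js x)] is the component of [x] orthogonal to the range of [J]. *)
Lemma hdot_compl (x : H) u : hdot (J u) (x - J (Js x)) = 0.
Proof. by rewrite hdotBr !JJs JsJ subrr. Qed.

(** The projection onto the orthogonal complement of the range of [J] vanishes
    on that range and does not increase norms, so it also kills every limit of
    range points. *)
Lemma hclosure_range : hclosure (range J) = range J.
Proof.
apply/seteqP; split=> [x xcl|_ [u _ <-] e e0]; last first.
  by exists (J u); [exists u|rewrite subrr /hnorm hdot0l sqrtr0].
exists (Js x) => //; apply/esym/eqP; rewrite -subr_eq0 -hnorm_eq0 expf_eq0 /=.
rewrite eq_le hnorm_ge0 andbT; apply/ler_addgt0Pl => e e0; rewrite addr0.
have [_ [u _ <-] xe] := xcl e e0; apply: le_trans (ltW xe).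
set w := x - J u; rewrite hnorm_le_hdot.
have -> : x - J (Js x) = w - J (Js w).
  by rewrite /w (linearB Js) JsJ (linearB J) opprB addrA subrK.
have := hdot_compl w (Js w); rewrite hdotBr => /subr0_eq h.
rewrite hdotBl hdot_compl subr0 hdotBr gerBl hdotC h -hdotC.
exact: hdot_ge0.
Qed.

(** The only positive square root of [J M J^*] is [J s J^*], where [s] is the
    root of [M]. Indeed a positive square root [S] of [A] kills [ker A], since
    [|S x|^2 = <A x, x>], and by symmetry it maps into the orthogonal
    complement of that kernel. So [S] lives on the range of [J], and uniqueness
    for matrices applies to [J^* S J]. *)
Lemma possqrt_compression (A : H -> H) (M s : 'M[C]_d) :
  pdmx s -> s *m s = M -> (forall x, A x = J (M *m Js x)) ->
  possqrt A = fun x => J (s *m Js x).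
Proof.
move=> ps ssM AE; apply: xget_unique.
  split=> [a x y|x|x].
  - by rewrite [Js _]linearP mulmxDr -scalemxAr linearP.
  - by rewrite JJs; exact: pdmx_psd.
  - by rewrite JsJ mulmxA ssM AE.
move=> S [Slin Spos SS].
pose S' : {linear H -> H} := HB.pack S (GRing.isLinear.Build _ _ _ _ S Slin).
have Ssym := positive_symmetric _ Slin Spos.
have Sker k : Js k = 0 -> S k = 0.
  move=> k0; apply/eqP; rewrite -hdot_eq0 Ssym SS AE k0 mulmx0 linear0.
  by rewrite hdot0r.
have Jsc x : Js (x - J (Js x)) = 0 by rewrite linearB /= JsJ subrr.
have Sran u : S (J u) = J (Js (S (J u))).
  set y := S (J u); apply/eqP; rewrite -subr_eq0 -hdot_eq0.
  rewrite hdotBl hdot_compl subr0 {1}/y Ssym Sker ?hdot0r //.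
have SE x : S x = S (J (Js x)).
  apply/eqP; rewrite -subr_eq0 -[_ - _](linearB S') /=.
  by apply/eqP/Sker.
pose t := mx_of_op (Js \o S' \o J).
have tE u : t *m u = Js (S (J u)) by rewrite mx_of_opE.
have st : s = t.
  apply: psd_sqrt_unique => //.
    by move=> u; rewrite tE hdotC -JJs -hdotC.
  apply/matrixP => i j; rewrite ssM.
  have : M *m delta_mx j 0 = t *m t *m (delta_mx j 0 : 'cV[C]_d).
    by rewrite -mulmxA !tE -Sran SS AE JsJ JsJ.
  by rewrite -!colE => /matrixP/(_ i 0); rewrite !mxE.
by apply/funext => x; rewrite SE Sran st tE.
Qed.

End Compression.

(** The compression lemma with [J] the identity of [C^d]. *)
Lemma defect_mxE {R : realType} {d : nat} (G s s' : 'M[R[i]]_d) :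
  pdmx s -> pdmx s' ->
  s *m s = 1%:M - adjmx G *m G -> s' *m s' = 1%:M - G *m adjmx G ->
  defect_mx G = s /\ defect_adj_mx G = s'.
Proof.
move=> ps ps' ss ss'; rewrite /defect_mx /defect_adj_mx.
pose I : {linear 'cV[R[i]]_d -> 'cV[R[i]]_d} := idfun.
have Gadj : adjoint (mulmx G : 'cV[R[i]]_d -> 'cV[R[i]]_d) = mulmx (adjmx G).
  by apply: adjointE => x y; rewrite hdot_mulmxl.
have root (A : 'cV[R[i]]_d -> 'cV[R[i]]_d) (M r : 'M[R[i]]_d) :
    pdmx r -> r *m r = M -> (forall x, A x = M *m x) ->
    mx_of_op (possqrt A) = r.
  move=> pr rr AE; rewrite (possqrt_compression I I _ _ A M r) //.
  exact: mx_of_op_mulmx.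
split; [apply: root ps ss _ => x|apply: root ps' ss' _ => x];
  by rewrite Gadj mulmxBl mul1mx mulmxA.
Qed.

Lemma finite_adjoint_exists {R : realType} {H : preHilbertType R} {d : nat}
    (A : {linear 'cV[R[i]]_d -> H}) :
  exists A' : {linear H -> 'cV[R[i]]_d},
    forall x y, hdot (A x) y = hdot x (A' y).
Proof.
pose A' (y : H) : 'cV[R[i]]_d := \col_j hdot y (A (delta_mx j 0)).
have AA' x y : hdot (A x) y = hdot x (A' y).
  rewrite [in LHS](cV_sum_delta x) linear_sum hdot_suml.
  by apply: eq_bigr => j _; rewrite linearZ hdotZl mxE -hdotC.
pose A'' : {linear H -> 'cV[R[i]]_d} :=
  HB.pack A' (GRing.isLinear.Build _ _ _ _ A' (linear_of_adjoint _ _ AA')).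
by exists A''.
Qed.

(** * Strict contractions and the Moebius identities *)

Section StrictContractions.
Context {R : realType} {d : nat}.
Local Notation C := R[i].
Implicit Types G t s : 'M[C]_d.

Lemma hdot_defect G (x : 'cV[C]_d) :
  hdot ((1%:M - adjmx G *m G) *m x) x = hdot x x - hdot (G *m x) (G *m x).
Proof. by rewrite mulmxBl mul1mx hdotBl -mulmxA (hdot_mulmxl (adjmx G)) adjmxK. Qed.

Lemma pdmx1 : pdmx (1%:M : 'M[C]_d).
Proof. by move=> x x0; rewrite mul1mx lt_def hdot_eq0 x0 hdot_ge0. Qed.

Lemma strict_contraction_pd G :
  strict_contraction G -> pdmx (1%:M - adjmx G *m G).
Proof.
by move=> hG x x0; rewrite hdot_defect subr_gt0 -hnorm_lt_hdot; exact: hG.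
Qed.

(** Expanding [0 <= |x - G G^* x|^2] bounds [|x|^2 - |G^* x|^2] below by
    [|G^* x|^2 - |G G^* x|^2]. *)
Lemma strict_contraction_adj G :
  strict_contraction G -> strict_contraction (adjmx G).
Proof.
move=> hG x x0; rewrite hnorm_lt_hdot; set y := adjmx G *m x.
have [->|y0] := eqVneq y 0.
  by rewrite hdot0l lt_def hdot_eq0 x0 hdot_ge0.
have := hG y y0; rewrite hnorm_lt_hdot -subr_gt0 => Gy.
have := hdot_ge0 (x - G *m y).
rewrite hdotBl !hdotBr (hdot_mulmxl G y x) (hdot_mulmxr G x y) -/y => h.
rewrite -subr_gt0; apply: lt_le_trans Gy _.
by rewrite -subr_ge0; apply: le_trans h _; rewrite le_eqVlt; apply/orP; left;
  apply/eqP; ring.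
Qed.

(** The difference of the two sides solves a Sylvester equation, because
    [G (I - G^* G) = (I - G G^* ) G]. *)
Lemma defect_intertwine G s s' : pdmx s -> pdmx s' ->
  s *m s = 1%:M - adjmx G *m G -> s' *m s' = 1%:M - G *m adjmx G ->
  G *m s = s' *m G.
Proof.
move=> ps ps' ss ss'; apply/eqP; rewrite -subr_eq0; apply/eqP.
apply: sylvester_eq0 ps' (pdmx_psd _ ps) _.
rewrite mulmxBr mulmxBl !mulmxA ss' -(mulmxA G) ss mulmxBl mulmxBr.
by rewrite mul1mx mulmx1 !mulmxA addrA subrK subrr.
Qed.

(** A fixed vector of [t G] or of [G t] would have its norm strictly decreased. *)
Lemma contraction_unitmx G t : strict_contraction G ->
  (forall x : 'cV[C]_d, hnorm (t *m x) <= hnorm x) ->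
  (1%:M - t *m G \in unitmx) /\ (1%:M - G *m t \in unitmx).
Proof.
move=> hG ht; split; apply: unitmx_ker0 => x; rewrite mulmxBl mul1mx => /subr0_eq e;
  apply/eqP/negPn/negP => x0.
  have := le_lt_trans (ht (G *m x)) (hG x x0).
  by rewrite mulmxA -e ltxx.
have tx0 : t *m x != 0.
  by apply: contra x0 => /eqP tx; rewrite e -mulmxA tx mulmx0.
have := lt_le_trans (hG _ tx0) (ht x).
by rewrite mulmxA -e ltxx.
Qed.

End StrictContractions.

Section MatrixIdentities.
Context {R : realType} {d : nat}.
Local Notation C := R[i].
Implicit Types G A t s : 'M[C]_d.

Lemma push_through A t : 1%:M - t *m A \in unitmx -> 1%:M - A *m t \in unitmx ->
  invmx (1%:M - t *m A) *m t = t *m invmx (1%:M - A *m t).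
Proof.
move=> u u'; apply: (can_inj (mulKmx u)); rewrite mulmxA mulmxV // mul1mx.
rewrite mulmxA mulmxBl mul1mx -(mulmxA t A t).
by rewrite -{2}[t]mulmx1 -mulmxBr mulmxK.
Qed.

Context (G A t s s' : 'M[C]_d).
Context (ss : s *m s = 1%:M - A *m G) (ss' : s' *m s' = 1%:M - G *m A).
Context (Gs : G *m s = s' *m G).
Context (us : s \in unitmx) (us' : s' \in unitmx).
Context (u : 1%:M - t *m A \in unitmx) (u' : 1%:M - A *m t \in unitmx).

Local Notation th := (s' *m (invmx (1%:M - t *m A) *m t) *m s - G).

(** After multiplication by [s] on the right, [s^2 = I - A G] and
    [G s = s' G] leave the common factor [s'], and the rest is
    [W = I + W t A] for [W = (I - t A)^-1]. *)
Lemma mobius_right :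
  th = s' *m invmx (1%:M - t *m A) *m (t - G) *m invmx s.
Proof.
apply: (can_inj (mulmxK us)); rewrite mulmxKV //.
rewrite mulmxBl -(mulmxA _ s s) ss Gs -!mulmxA -mulmxBr; congr (_ *m _).
set W := invmx _.
have WE : W = 1%:M + W *m (t *m A).
  by apply/eqP; rewrite -subr_eq -{1}[W]mulmx1 -mulmxBr mulVmx.
rewrite !mulmxBr mulmx1 -addrA; congr (_ + _).
by rewrite {2}WE mulmxDl mul1mx opprD addrC -!mulmxA.
Qed.

(** Mirror image: the push-through identity moves the inverse to the right of
    [t], and one multiplies by [s'] on the left. *)
Lemma mobius_left :
  th = invmx s' *m (t - G) *m invmx (1%:M - A *m t) *m s.
Proof.
rewrite push_through //.
apply: (can_inj (mulKmx us')); rewrite -!mulmxA mulKVmx //.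
rewrite mulmxBr -Gs (mulmxA s' s') ss' !mulmxA -mulmxBl.
congr (_ *m _); set W := invmx _.
have WE : W = 1%:M + A *m t *m W.
  by apply/eqP; rewrite -subr_eq -{1}[W]mul1mx -mulmxBl mulmxV.
rewrite !mulmxBl mul1mx -addrA; congr (_ + _).
by rewrite {2}WE mulmxDr mulmx1 opprD addrC !mulmxA.
Qed.

End MatrixIdentities.

(** * Finite-dimensional perturbations of a unitary operator *)

Section UnitaryPerturbation.
Context {R : realType} {H : preHilbertType R} {d : nat}.
Local Notation C := R[i].
Context (U Us R0 : {linear H -> H}) (z : C).
Context (B : {linear 'cV[C]_d -> H}) (Bs : {linear H -> 'cV[C]_d}).
Context (UUs : cancel Us U) (UsU : cancel U Us).
Context (Uadj : forall x y, hdot (U x) y = hdot x (Us y)).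
Context (BBs : forall x y, hdot (B x) y = hdot x (Bs y)).
Context (BsB : forall x, Bs (B x) = x).
Context (R0K : forall x, R0 (x - z *: Us x) = x).
Context (KR0 : forall x, R0 x - z *: Us (R0 x) = x).
Context (hz : `|z| < 1).

Definition perturb (G : 'M[C]_d) (x : H) : H :=
  U x + B ((G - 1%:M) *m Bs (U x)).

Definition perturb_adj (G : 'M[C]_d) (y : H) : H :=
  Us (y + B ((adjmx G - 1%:M) *m Bs y)).

Lemma perturb_adjoint G x y :
  hdot (perturb G x) y = hdot x (perturb_adj G y).
Proof.
rewrite -Uadj hdotDl hdotDr BBs [hdot (U x) (B _)]hdotC BBs -hdotC.
by rewrite hdot_mulmxl adjmxB adjmx1.
Qed.

Lemma Bs_perturb G x : Bs (perturb G x) = G *m Bs (U x).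
Proof. by rewrite linearD /= BsB mulmxBl mul1mx addrC subrK. Qed.

Lemma Bs_perturb_adj G y : Bs (U (perturb_adj G y)) = adjmx G *m Bs y.
Proof. by rewrite UUs linearD /= BsB mulmxBl mul1mx addrC subrK. Qed.

Lemma perturb_defect G x :
  x - perturb_adj G (perturb G x) =
  Us (B ((1%:M - adjmx G *m G) *m Bs (U x))).
Proof.
rewrite /perturb_adj Bs_perturb /perturb -addrA -(linearD B) (linearD Us) UsU.
rewrite opprD addNKr -(linearN Us) -(linearN B) mulmxA -mulmxDl -mulNmx.
by rewrite mulmxBl mul1mx addrC addrA subrK opprB.
Qed.

Lemma perturb_defect_adj G y :
  y - perturb G (perturb_adj G y) = B ((1%:M - G *m adjmx G) *m Bs y).
Proof.
rewrite /perturb Bs_perturb_adj UUs -addrA -(linearD B).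
rewrite opprD addNKr -(linearN B) mulmxA -mulmxDl -mulNmx.
by rewrite mulmxBl mul1mx addrC addrA subrK opprB.
Qed.

Let J : {linear 'cV[C]_d -> H} := Us \o B.
Let Js : {linear H -> 'cV[C]_d} := Bs \o U.

Let JJs x y : hdot (J x) y = hdot x (Js y).
Proof. by rewrite /= -BBs [LHS]hdotC -Uadj -hdotC. Qed.

Let JsJ x : Js (J x) = x.
Proof. by rewrite /= UUs BsB. Qed.

Lemma perturbJ G y : perturb G (J y) = B (G *m y).
Proof.
by rewrite /perturb /= UUs BsB -linearD /= mulmxBl mul1mx addrC subrK.
Qed.

(** The matrix [z B^* (I - z U^* )^-1 U^* B], that is, the Cauchy integral of
    the matrix-valued spectral measure of [U]. *)
Definition cauchy_mx : 'M[C]_d := z *: mx_of_op (Bs \o R0 \o J).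

Lemma cauchy_mxE x : cauchy_mx *m x = z *: Bs (R0 (J x)).
Proof. by rewrite -scalemxAl mx_of_opE. Qed.

Let F := cauchy_mx.

(** [I + 2 F = B^* (I + z U^* )(I - z U^* )^-1 B] has nonnegative real part: with
    [w = (I - z U^* )^-1 U^* B x] one has [B x = U w - z w], and the form below is
    [(1 - |z|^2) |w|^2]. *)
Lemma cauchy_mx_accretive x :
  0 <= hdot x x + hdot (F *m x) x + hdot x (F *m x).
Proof.
pose w := R0 (J x).
have Bx : B x = U w - z *: w.
  by rewrite -[B x]UUs -[Us (B x)]/(J x) -[J x]KR0 -/w linearB linearZ /= UUs.
have UwUw : hdot (U w) (U w) = hdot w w by rewrite Uadj UsU.
have e1 : hdot x x = hdot (B x) (B x) by rewrite BBs BsB.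
have e2 : hdot (F *m x) x = z * hdot w (B x).
  by rewrite cauchy_mxE hdotZl [hdot w _]hdotC BBs -hdotC.
rewrite [hdot x (F *m x)]hdotC e2 e1 Bx !(hdotBl, hdotBr, hdotZl, hdotZr).
rewrite rmorphM rmorphB rmorphM /= conjCK -!hdotC UwUw.
rewrite (_ : _ + _ = (1 - z * Num.conj z) * hdot w w); last by ring.
by rewrite mulr_ge0 ?hdot_ge0 // subr_ge0 -normCK expr_le1 // ltW.
Qed.

Lemma one_plus_cauchy_unit : 1%:M + F \in unitmx.
Proof.
apply: unitmx_ker0 => x; rewrite mulmxDl mul1mx addrC => /eqP.
rewrite addr_eq0 => /eqP e; have := cauchy_mx_accretive x.
rewrite e hdotNl [hdot x (- x)]hdotC hdotNl rmorphN /= -hdotC subrr add0r oppr_ge0.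
by move=> h; apply/eqP; rewrite -hdot_eq0 eq_le h hdot_ge0.
Qed.

(** This is the characteristic function at [G = 0]. *)
Definition theta0_mx : 'M[C]_d := invmx (1%:M + F) *m F.

(** With [x = u + F u] one has [theta0 x = F u], and
    [|u + F u|^2 - |F u|^2 = |u|^2 + 2 Re <F u, u>]. *)
Lemma theta0_mx_contractive x : hnorm (theta0_mx *m x) <= hnorm x.
Proof.
pose u := invmx (1%:M + F) *m x.
have xE : x = u + F *m u.
  by rewrite -{1}[u]mul1mx -mulmxDl mulKVmx ?one_plus_cauchy_unit.
have tE : theta0_mx *m x = F *m u.
  have cF : (1%:M + F) *m F = F *m (1%:M + F).
    by rewrite mulmxDl mulmxDr mul1mx mulmx1.
  rewrite -[RHS](mulKmx one_plus_cauchy_unit) (mulmxA _ F) cF -mulmxA.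
  by rewrite mulKVmx ?one_plus_cauchy_unit // /theta0_mx mulmxA.
rewrite hnorm_le_hdot tE xE hdotDl !hdotDr addrA -subr_ge0 addrK.
by rewrite addrAC; exact: cauchy_mx_accretive.
Qed.

(** The left side is the finite-dimensional obstruction to inverting
    [I - z T^*] for the perturbation with [A = G^*]; the factorization reduces
    it to [I - theta0 G^*]. *)
Lemma one_plus_cauchyE A :
  1%:M - F *m (A - 1%:M) = (1%:M + F) *m (1%:M - theta0_mx *m A).
Proof.
rewrite [RHS]mulmxBr mulmx1 !mulmxA mulmxV ?one_plus_cauchy_unit // mul1mx.
by rewrite mulmxBr mulmx1 opprB addrA addrAC.
Qed.

Lemma resolvent_mx A : 1%:M - theta0_mx *m A \in unitmx ->
  invmx (1%:M - F *m (A - 1%:M)) *m F = invmx (1%:M - theta0_mx *m A) *m theta0_mx.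
Proof.
move=> uA; have uN : 1%:M - F *m (A - 1%:M) \in unitmx.
  by rewrite one_plus_cauchyE unitmx_mul one_plus_cauchy_unit.
apply: (can_inj (mulKmx uN)); rewrite mulKVmx // one_plus_cauchyE.
rewrite -(mulmxA (1%:M + F)) mulKVmx //.
by rewrite /theta0_mx mulKVmx // one_plus_cauchy_unit.
Qed.

(** [I - z T^*] differs from [I - z U^*] by [z J (A - I) B^*], which factors
    through [C^d]. Applying [B^* R0] to [(I - z T^* ) w = v] gives a linear
    system for the vector [B^* w] with matrix [I - F (A - I)]; its solution
    determines [w]. *)
Lemma opinv_perturb G (A := adjmx G) : 1%:M - theta0_mx *m A \in unitmx ->
  opinv (fun w => w - z *: perturb_adj G w) =
  (fun v => R0 v + z *: R0 (J ((A - 1%:M) *m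
     (invmx (1%:M - F *m (A - 1%:M)) *m Bs (R0 v))))).
Proof.
move=> uA; have uN : 1%:M - F *m (A - 1%:M) \in unitmx.
  by rewrite one_plus_cauchyE unitmx_mul one_plus_cauchy_unit.
have LE w : w - z *: perturb_adj G w =
    (w - z *: Us w) - z *: J ((A - 1%:M) *m Bs w).
  by rewrite /perturb_adj linearD scalerDr opprD addrA.
set N := 1%:M - _ in uN *.
apply: opinvE => [w|v] /=; rewrite LE.
  have BR0 : Bs (R0 ((w - z *: Us w) - z *: J ((A - 1%:M) *m Bs w))) = N *m Bs w.
    rewrite (linearB R0) R0K (linearZ_LR R0) (linearB Bs) (linearZ_LR Bs).
    by rewrite -cauchy_mxE /N (mulmxBl 1%:M) mul1mx mulmxA.
  rewrite BR0 mulKmx // (linearB R0) R0K (linearZ_LR R0).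
  by rewrite subrK.
set b := invmx N *m Bs (R0 v).
set v' := R0 v + _.
have Bv' : Bs v' = b.
  rewrite /v' (linearD Bs) (linearZ_LR Bs) -cauchy_mxE.
  rewrite -[Bs (R0 v)](mulKVmx uN) -/b {1}/N (mulmxBl 1%:M) mul1mx mulmxA.
  by rewrite subrK.
rewrite Bv' /v' (linearD Us) scalerDr opprD addrACA KR0.
rewrite (linearZ_LR Us) -scalerBr KR0.
by rewrite addrK.
Qed.

(** [I - T^* T = J (I - G^* G) J^*] and [I - T T^* = B (I - G G^* ) B^*], so both
    defect operators are compressions of matrices, [J] inverts the coordinate
    operator on the defect space, and only the compression
    [z B^* (I - z T^* )^-1 J] of the resolvent enters. *)
Lemma charfun_perturb G s s' : pdmx s -> pdmx s' ->
  s *m s = 1%:M - adjmx G *m G -> s' *m s' = 1%:M - G *m adjmx G ->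
  1%:M - theta0_mx *m adjmx G \in unitmx ->
  mx_of_op (charfun (perturb G) (fun x => Bs (U x)) Bs z) =
  s' *m (invmx (1%:M - theta0_mx *m adjmx G) *m theta0_mx) *m s - G.
Proof.
move=> ps ps' ss ss' uA.
have Tadj : adjoint (perturb G) = perturb_adj G.
  by apply: adjointE; exact: perturb_adjoint.
have DT : defect (perturb G) = fun x => J (s *m Js x).
  apply: (possqrt_compression _ _ JJs JsJ _ _ _ ps ss) => x.
  by rewrite Tadj perturb_defect.
have DTs : defect_adj (perturb G) = fun x => B (s' *m Bs x).
  apply: (possqrt_compression _ _ BBs BsB _ _ _ ps' ss') => x.
  by rewrite Tadj perturb_defect_adj.
have us : s \in unitmx by exact: pdmx_unit.
have DS : defect_space (perturb G) = range J.
  rewrite /defect_space DT -(hclosure_range _ _ JJs JsJ); congr hclosure.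
  apply/seteqP; split=> [_ [x _ <-]|_ [u _ <-]]; first by exists (s *m Js x).
  by exists (J (invmx s *m u)) => //; rewrite JsJ mulKVmx.
have VE : adjoint_on (defect_space (perturb G)) (fun x => Bs (U x)) = J.
  rewrite DS; apply: adjoint_onE => [_ _ [u _ <-] [v _ <-]|y|_ y [u _ <-]].
  - by exists (u - v) => //; rewrite linearB.
  - by exists y.
  - by rewrite -[Bs _]/(Js (J u)) JsJ JJs JsJ.
rewrite -[RHS]mx_of_op_mulmx; congr mx_of_op; apply/funext => y.
rewrite /charfun VE Tadj DT DTs JsJ perturbJ opinv_perturb //.
set N := 1%:M - F *m _.
have uN : N \in unitmx.
  by rewrite /N one_plus_cauchyE unitmx_mul one_plus_cauchy_unit.
have NF := resolvent_mx _ uA; rewrite -/N in NF.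
(* [K] computes the compression [z B^* (I - z T^* )^-1 J] of the resolvent *)
have K x : z *: Bs (R0 (J x) + z *: R0 (J ((adjmx G - 1%:M) *m
    (invmx N *m Bs (R0 (J x)))))) = invmx N *m F *m x.
  rewrite (linearD Bs) scalerDr (linearZ_LR Bs) -!cauchy_mxE -/F.
  rewrite [z *: (F *m _)]scalemxAr [z *: (_ *m _)]scalemxAr [z *: (_ *m _)]scalemxAr.
  rewrite -cauchy_mxE -/F.
  rewrite -{1}[F *m x](mulKVmx uN) {1}/N (mulmxBl 1%:M) mul1mx !mulmxA subrK.
  by rewrite -!mulmxA.
rewrite (linearD Bs) (linearN Bs) BsB (linearZ_LR Bs) BsB.
rewrite (scalemxAr z s') K NF addrC mulmxBl; congr (_ - _).
by rewrite !mulmxA.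
Qed.

End UnitaryPerturbation.

(** * Multiplication operators on the direct integral *)

Section MultiplicationOperators.
Context {R : realType} {E : hilbertType R} {eps : orthonormal_basis E}.
Context {mu : {finite_measure set (circle R) -> \bar R}}.
Context {N : circle R -> option nat}.
Local Notation C := R[i].
Local Notation H := (direct_integral eps mu N).
Implicit Types (x y : H) (phi : circle R -> C) (M : H -> H).

(** A relation and not a construction: identities between multiplication
    operators then reduce to identities between symbols. *)
Definition multiplies phi M : Prop :=
  forall x, {ae mu, forall xi, repr (M x) xi = phi xi *: repr x xi}.

Lemma repr_ae_inj x y : {ae mu, forall xi, repr x xi = repr y xi} -> x = y.
Proof. by move=> xy; rewrite -[x]reprK -[y]reprK; apply/di_eqP. Qed.

Lemma repr_linear_ae a x y :
  {ae mu, forall xi, repr (a *: x + y) xi = a *: repr x xi + repr y xi}.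
Proof.
have e : a *: x + y = \pi_(direct_integral eps mu N)%qT (a *: repr x + repr y).
  by rewrite di_piD di_piZ !reprK.
by apply: filterS (repr_ae (a *: repr x + repr y)) => xi; rewrite -e.
Qed.

Lemma multiplies_linear phi M : multiplies phi M -> linear M.
Proof.
move=> hM a x y; apply: repr_ae_inj.
apply: filterS2 (filterI (hM (a *: x + y)) (repr_linear_ae a x y))
  (filterI (repr_linear_ae a (M x) (M y)) (filterI (hM x) (hM y))).
move=> xi [-> ->] [-> [-> ->]].
by rewrite scalerDr !scalerA mulrC.
Qed.

Lemma multiplies_mul_xi : multiplies (fun xi => xi : C) (@mul_xi _ _ eps mu N).
Proof. by move=> x; exact: repr_ae. Qed.

Lemma multiplies_exists phi (k : R) :
  measurable_fun setT (fun xi => complex.Re (phi xi)) ->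
  measurable_fun setT (fun xi => complex.Im (phi xi)) ->
  (forall xi, `|phi xi| ^+ 2 <= k%:C%C) ->
  exists M : {linear H -> H}, multiplies phi M.
Proof.
move=> mRe mIm bnd.
have sub (f : di_section eps mu N) : (fun xi => phi xi *: f xi) \in di_fun eps mu N.
  have /di_funP[fL fE] := di_valP f; apply/di_funP; split.
    apply: (@square_integrableP _ _ eps mu f f _ k 0 fL fL).
      exact: weakly_measurableM fL.1.
    move=> xi; rewrite mul0r addr0 hnorm_sqrZ ler_wpM2r ?sqr_ge0 //.
    by rewrite -lecR add_Re2_Im2.
  by apply: filterS fE => xi; exact: closed_spanZ.
pose M x : H := \pi_(direct_integral eps mu N)%qT (DISection (sub (repr x))).
have hM : multiplies phi M by move=> x; exact: repr_ae.
pose M' : {linear H -> H} :=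
  HB.pack M (GRing.isLinear.Build _ _ _ _ M (multiplies_linear _ _ hM)).
by exists M'.
Qed.

Lemma hdot_ae x y x' y' :
  {ae mu, forall xi, hdot (repr x xi) (repr y xi) =
                     hdot (repr x' xi) (repr y' xi)} ->
  hdot x y = hdot x' y'.
Proof.
move=> h; congr (_ +i* _)%C; apply: ae_Rintegral;
  do ?[exact: integrable_Re_hdot|exact: integrable_Im_hdot];
  by apply: filterS h => xi ->.
Qed.

Lemma multiplies_adjoint phi M M' : multiplies phi M ->
  multiplies (fun xi => Num.conj (phi xi)) M' ->
  forall x y, hdot (M x) y = hdot x (M' y).
Proof.
move=> hM hM' x y; apply: hdot_ae.
apply: filterS2 (hM x) (hM' y) => xi -> ->.
by rewrite hdotZl hdotZr conjCK.
Qed.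

Lemma multiplies_comp phi psi M M' : multiplies phi M -> multiplies psi M' ->
  multiplies (fun xi => phi xi * psi xi) (M \o M').
Proof.
move=> hM hM' x; apply: filterS2 (hM (M' x)) (hM' x) => xi -> ->.
by rewrite scalerA.
Qed.

Lemma multiplies1 phi M : multiplies phi M -> (forall xi, phi xi = 1) ->
  forall x, M x = x.
Proof.
move=> hM h1 x; apply: repr_ae_inj; apply: filterS (hM x) => xi ->.
by rewrite h1 scale1r.
Qed.

Lemma multiplies_one_sub z phi M : multiplies phi M ->
  multiplies (fun xi => 1 - z * phi xi) (fun x => x - z *: M x).
Proof.
move=> hM x; rewrite addrC -scaleNr.
apply: filterS2 (repr_linear_ae (- z) (M x) x) (hM x) => xi -> ->.
by rewrite scalerA addrC mulNr scaleNr scalerBl scale1r.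
Qed.

Lemma mul_xi_inverse_exists : exists Us : {linear H -> H},
  multiplies (fun xi => Num.conj (xi : C)) Us.
Proof.
apply: (multiplies_exists _ 1).
- under eq_fun do rewrite cRe_conj; exact: measurable_circle_Re.
- under eq_fun do rewrite cIm_conj.
  by apply: measurableT_comp => //; exact: measurable_circle_Im.
- by move=> xi; rewrite norm_conjC circle_norm expr1n.
Qed.

Lemma one_sub_norm (z : C) (xi : circle R) :
  1 - `|z| <= `|1 - z * Num.conj (xi : C)|.
Proof.
have := lerB_normD 1 (- (z * Num.conj (xi : C))).
by rewrite normrN normr1 normrM norm_conjC circle_norm mulr1.
Qed.

(** The resolvent of [U^*] is multiplication by a symbol that is bounded by
    [(1 - |z|)^-1]. *)
Lemma resolvent_exists (z : C) : `|z| < 1 -> exists R0 : {linear H -> H},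
  multiplies (fun xi => (1 - z * Num.conj (xi : C))^-1) R0.
Proof.
move=> hz.
pose w (xi : circle R) : C := 1 - z * Num.conj (xi : C).
have mRe : measurable_fun setT (fun xi => complex.Re (w xi)).
  rewrite (_ : (fun _ => _) = fun xi : circle R =>
    1 - (complex.Re z * complex.Re xi + complex.Im z * complex.Im xi)).
    apply: measurable_funB => //.
    apply: measurable_funD; apply: measurable_funM => //;
      [exact: measurable_circle_Re|exact: measurable_circle_Im].
  apply/funext => xi; rewrite /w; case: z {hz w} => a b.
  by case: (xi : C) => c e /=; ring.
have mIm : measurable_fun setT (fun xi => complex.Im (w xi)).
  rewrite (_ : (fun _ => _) = fun xi : circle R =>
    complex.Re z * complex.Im xi - complex.Im z * complex.Re xi).
    apply: measurable_funB; apply: measurable_funM => //;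
      [exact: measurable_circle_Im|exact: measurable_circle_Re].
  apply/funext => xi; rewrite /w; case: z {hz w mRe} => a b.
  by case: (xi : C) => c e /=; ring.
have mV : measurable_fun setT
    (fun xi => (complex.Re (w xi) ^+ 2 + complex.Im (w xi) ^+ 2)^-1).
  rewrite (_ : (fun _ => _) = (@powR R ^~ (-1)) \o
    (fun xi => complex.Re (w xi) ^+ 2 + complex.Im (w xi) ^+ 2)).
    apply: measurableT_comp; first exact: measurable_powR.
    by apply: measurable_funD; exact: measurable_funX.
  by apply/funext => xi; rewrite /= powR_inv1 // addr_ge0 ?sqr_ge0.
apply: (multiplies_exists _ (complex.Re ((1 - `|z|)^-1 ^+ 2))).
- rewrite (_ : (fun _ => _) = fun xi => complex.Re (w xi) *
    (complex.Re (w xi) ^+ 2 + complex.Im (w xi) ^+ 2)^-1).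
    exact: measurable_funM.
  apply/funext => xi; rewrite -/(w xi); by case: (w xi) => a b /=; rewrite ?mulNr mulrC.
- rewrite (_ : (fun _ => _) = fun xi => - complex.Im (w xi) *
    (complex.Re (w xi) ^+ 2 + complex.Im (w xi) ^+ 2)^-1).
    apply: measurable_funM => //. exact: measurableT_comp.
  apply/funext => xi; rewrite -/(w xi); by case: (w xi) => a b /=; rewrite ?mulNr mulrC.
- move=> xi; rewrite -/(w xi).
  have z1 : 0 < 1 - `|z| by rewrite subr_gt0.
  rewrite RRe_real ?ger0_real ?exprn_ge0 ?invr_ge0 ?(ltW z1) //.
  rewrite normfV ler_pXn2r ?nnegrE ?invr_ge0 ?(ltW z1) //.
  have wz : 1 - `|z| <= `|w xi| by exact: one_sub_norm.
  by rewrite lef_pV2 ?posrE // (lt_le_trans z1).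
Qed.


End MultiplicationOperators.

(** * The relation between the characteristic functions *)

Theorem theorem5p1 (R : realType) (E : hilbertType R)
    (eps : orthonormal_basis E)
    (mu : {finite_measure set (circle R) -> \bar R})
    (N : circle R -> option nat)
    (hN : forall v : option nat, measurable [set xi | N xi = v])
    (d : nat)
    (B : 'cV[R[i]]_d -> direct_integral eps mu N)
    (hB_linear : linear B) (hB_isometry : forall x, hnorm (B x) = hnorm x)
    (G : 'M[R[i]]_d) (hG : strict_contraction G)
    (z : R[i]) (hz : `|z| < 1) :
  [/\ defect_mx G \in unitmx, defect_adj_mx G \in unitmx,
      1%:M - adjmx G *m theta B 0 z \in unitmx &
      1%:M - theta B 0 z *m adjmx G \in unitmx] /\
  theta B G z =
    invmx (defect_adj_mx G) *m (theta B 0 z - G) *m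
      invmx (1%:M - adjmx G *m theta B 0 z) *m defect_mx G /\
  theta B G z =
    defect_adj_mx G *m invmx (1%:M - theta B 0 z *m adjmx G) *m
      (theta B 0 z - G) *m invmx (defect_mx G).
Proof.
have [Us hUs] := @mul_xi_inverse_exists R E eps mu N.
have [R0 hR0] := @resolvent_exists R E eps mu N z hz.
have hU := @multiplies_mul_xi R E eps mu N.
pose U : {linear direct_integral eps mu N -> direct_integral eps mu N} :=
  HB.pack (@mul_xi _ _ eps mu N)
    (GRing.isLinear.Build _ _ _ _ _ (multiplies_linear _ _ hU)).
pose Bl : {linear 'cV[R[i]]_d -> direct_integral eps mu N} :=
  HB.pack B (GRing.isLinear.Build _ _ _ _ _ hB_linear).
have Uadj : forall x y, hdot (U x) y = hdot x (Us y).
  exact: multiplies_adjoint hU hUs.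
have xi1 (xi : circle R) : (xi : R[i]) * Num.conj (xi : R[i]) = 1.
  by rewrite -normCK circle_norm expr1n.
have UUs : cancel Us U.
  by apply: (multiplies1 _ _ (multiplies_comp _ _ _ _ hU hUs)) => xi.
have UsU : cancel U Us.
  apply: (multiplies1 _ _ (multiplies_comp _ _ _ _ hUs hU)) => xi.
  by rewrite mulrC.
have h1 := multiplies_one_sub z _ _ hUs.
have w0 (xi : circle R) : 1 - z * Num.conj (xi : R[i]) != 0.
  rewrite -normr_gt0; apply: lt_le_trans (one_sub_norm z xi).
  by rewrite subr_gt0.
have R0K x : R0 (x - z *: Us x) = x.
  apply: (multiplies1 _ _ (multiplies_comp _ _ _ _ hR0 h1)) => xi.
  by rewrite mulVf.
have KR0 x : R0 x - z *: Us (R0 x) = x.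
  apply: (multiplies1 _ _ (multiplies_comp _ _ _ _ h1 hR0)) => xi.
  by rewrite mulfV.
have [Bs BBs] : exists Bs : {linear direct_integral eps mu N -> 'cV[R[i]]_d},
    forall x y, hdot (B x) y = hdot x (Bs y).
  exact: (finite_adjoint_exists Bl).
have BsB x : Bs (B x) = x.
  by apply: hdot_injr => u; rewrite -BBs (isometry_hdot _ hB_linear hB_isometry).
have BsE : adjoint B = Bs by exact: adjointE.
have [s ps ss] := pd_sqrt_exists _ (strict_contraction_pd _ hG).
have [s' ps' ss'] :=
  pd_sqrt_exists _ (strict_contraction_pd _ (strict_contraction_adj _ hG)).
rewrite adjmxK in ss'.
have [dE daE] := defect_mxE _ _ _ ps ps' ss ss'.
have us := pdmx_unit _ ps.
have us' := pdmx_unit _ ps'.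
pose t := theta0_mx Us R0 z Bl Bs.
have tcon : forall x, hnorm (t *m x) <= hnorm x.
  exact: (theta0_mx_contractive U Us R0 z Bl Bs UUs UsU Uadj BBs BsB KR0 hz).
have [u u'] : 1%:M - t *m adjmx G \in unitmx /\ 1%:M - adjmx G *m t \in unitmx.
  exact: contraction_unitmx (strict_contraction_adj _ hG) tcon.
have thetaE := charfun_perturb U Us R0 z Bl Bs UUs UsU Uadj BBs BsB R0K KR0 hz.
have tE : theta B 0 z = t.
  rewrite /theta /perturbation BsE (thetaE 0 1%:M 1%:M pdmx1 pdmx1).
  - by rewrite adjmx0 mulmx0 !subr0 invmx1 mulmx1 !mul1mx.
  - by rewrite adjmx0 mulmx0 subr0 mulmx1.
  - by rewrite mul0mx subr0 mulmx1.
  - by rewrite adjmx0 mulmx0 subr0 unitmx1.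
have tG : theta B G z = s' *m (invmx (1%:M - t *m adjmx G) *m t) *m s - G.
  by rewrite /theta /perturbation BsE; exact: thetaE u.
have Gs := defect_intertwine _ _ _ ps ps' ss ss'.
rewrite tG tE dE daE; move: t {tcon tE tG} u u' => t u u'.
by split=> //; split; [exact: mobius_left|exact: mobius_right].
Qed.
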